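(* Let $\Lambda$ be a rank-$2$ Bratteli diagram which is cofinal and aperiodic, and let $K$ be a field. Then $\mathrm{KP}_K(\Lambda)$ is simple, but is neither purely infinite nor locally matricial.
   Context: $\mathbb N=\{0,1,2,\dots\}$; $e_1,e_2$ is the standard basis of $\mathbb N^2$ and $\leq$ on $\mathbb N^2$ is coordinatewise. A $2$-graph is a countable category $\Lambda$ with a functor $d:\Lambda\to\mathbb N^2$ (degree) satisfying the factorisation property: if $d(\lambda)=m+n$ with $m,n\in\mathbb N^2$, there are unique $\mu,\nu\in\Lambda$ with $d(\mu)=m$, $d(\nu)=n$, $\lambda=\mu\nu$. Morphisms are called paths; the set $\Lambda^0$ of objects (vertices) is identified with the paths of degree $0$; $r,s$ are the codomain (range) and domain (source) maps. Write $\Lambda^n=d^{-1}(n)$, $\Lambda^{\neq0}=\Lambda\setminus\Lambda^0$, $v\Lambda^n=\{\lambda\in\Lambda^n:r(\lambda)=v\}$, $v\Lambda w=\{\lambda\in\Lambda: r(\lambda)=v,s(\lambda)=w\}$. $\Lambda$ is row-finite if every $v\Lambda^n$ is finite, and has no sources if every $v\Lambda^n$ is nonempty. Rank-2 Bratteli diagram: a row-finite $2$-graph $\Lambda$ without sources such that $\Lambda^0=\bigsqcup_{n=0}^\infty V_n$ with each $V_n$ finite and nonempty; each blue edge (path of degree $e_1$) has source in $V_{n+1}$ and range in $V_n$ for some $n$, and every vertex in $V_n$ with $n\geq1$ is the source of a blue edge; and the red graph (vertices $\Lambda^0$, edges $\Lambda^{e_2}$) is a disjoint union of cycles (each vertex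 is the range of exactly one red edge and the source of exactly one red edge), the vertices of each cycle lying entirely in a single $V_n$. Infinite paths: let $\Omega_2$ be the $2$-graph with objects $\mathbb N^2$, morphisms $(p,q)$ with $p\leq q$, $r(p,q)=p$, $s(p,q)=q$, $d(p,q)=q-p$. An infinite path is a degree-preserving functor $x:\Omega_2\to\Lambda$; $x(n):=x(n,n)$; $v\Lambda^\infty$ is the set of infinite paths with $x(0)=v$; for $s(\lambda)=x(0)$, $\lambda x$ is the infinite path with $(\lambda x)(0,d(\lambda))=\lambda$ and $(\lambda x)(d(\lambda)+p,d(\lambda)+q)=x(p,q)$. $\Lambda$ is cofinal if for every infinite path $x$ and every $v\in\Lambda^0$ there is $n\in\mathbb N^2$ with $v\Lambda x(n)\neq\emptyset$. $\Lambda$ is aperiodic if for every $v\in\Lambda^0$ there is $x\in v\Lambda^\infty$ such that $\alpha\neq\beta$ in $\Lambda$ with $s(\alpha)=s(\beta)=v$ implies $\alpha x\neq\beta x$. Kumjian-Pask algebra: for each $\lambda\in\Lambda^{\neq0}$ let $\lambda^*$ be a formal symbol, and put $v^*=v$ for $v\in\Lambda^0$. $\mathrm{KP}_K(\Lambda)$ is the universal (not necessarily unital) $K$-algebra generated by elements $p_v$ ($v\in\Lambda^0$), $s_\lambda,s_{\lambda^*}$ ($\lambda\in\Lambda^{\neq0}$) subject to: (KP1) $p_vp_w=\delta_{v,w}p_v$; (KP2) $s_\lambda s_\mu=s_{\lambda\mu}$ and $s_{\mu^*}s_{\lambda^*}=s_{(\lambda\mu)^*}$ when $s(\lambda)=r(\mu)$,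 and $p_{r(\lambda)}s_\lambda=s_\lambda=s_\lambda p_{s(\lambda)}$, $p_{s(\lambda)}s_{\lambda^*}=s_{\lambda^*}=s_{\lambda^*}p_{r(\lambda)}$; (KP3) $s_{\lambda^*}s_\mu=\delta_{\lambda,\mu}p_{s(\lambda)}$ if $d(\lambda)=d(\mu)$; (KP4) $p_v=\sum_{\lambda\in v\Lambda^n}s_\lambda s_{\lambda^*}$ for $v\in\Lambda^0$, $n\in\mathbb N^2\setminus\{0\}$. An idempotent $p$ in a ring $A$ is infinite if there exist orthogonal nonzero idempotents $p_1,p_2\in A$ and $x\in pAp_1$, $y\in p_1Ap$ with $p=p_1+p_2$, $p=xy$ and $p_1=yx$. A simple ring is purely infinite if every nonzero right ideal contains an infinite idempotent. A matricial $K$-algebra is a finite direct product of full matrix algebras over $K$; a $K$-algebra is locally matricial if it is a direct limit of matricial $K$-algebras. *)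

(* Defs.v *)
From HB Require Import structures.
From mathcomp Require Import all_boot all_order all_algebra.
From mathcomp Require Import all_classical.

Set Implicit Arguments.
Unset Strict Implicit.
Unset Printing Implicit Defensive.

Import Order.TTheory GRing.Theory.
Local Open Scope classical_set_scope.
Local Open Scope ring_scope.

Notation deg2 := (nat * nat)%type.

Definition e1 : deg2 := (1, 0)%N.
Definition e2 : deg2 := (0, 1)%N.

Definition le2 (m n : deg2) : bool := (m.1 <= n.1)%N && (m.2 <= n.2)%N.

(* [pcomp l m] is the composite "l m", i.e. l after m; it is meaningful only
   when [smap l = rmap m].  A vertex [v] is the path [idp v] of degree 0; the
   factorisation property makes [idp] a bijection onto the paths of degree 0. *)
Record twoGraph := TwoGraph {
  vert : countType;
  gpath : countType;
  rmap : gpath -> vert;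
  smap : gpath -> vert;
  idp : vert -> gpath;
  pcomp : gpath -> gpath -> gpath;
  deg : gpath -> deg2;
  rmap_id : forall v, rmap (idp v) = v;
  smap_id : forall v, smap (idp v) = v;
  rmap_comp : forall l m, smap l = rmap m -> rmap (pcomp l m) = rmap l;
  smap_comp : forall l m, smap l = rmap m -> smap (pcomp l m) = smap m;
  comp_idl : forall l, pcomp (idp (rmap l)) l = l;
  comp_idr : forall l, pcomp l (idp (smap l)) = l;
  pcompA : forall l m n, smap l = rmap m -> smap m = rmap n ->
    pcomp l (pcomp m n) = pcomp (pcomp l m) n;
  deg_id : forall v, deg (idp v) = 0;
  deg_comp : forall l m, smap l = rmap m -> deg (pcomp l m) = deg l + deg m;
  factorisation : forall l (m n : deg2), deg l = m + n ->
    exists! mn : gpath * gpath,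
      [/\ deg mn.1 = m, deg mn.2 = n, smap mn.1 = rmap mn.2
        & l = pcomp mn.1 mn.2]
}.

Record tgFunctor (L M : twoGraph) := TgFunctor {
  fobj : vert L -> vert M;
  fmor : gpath L -> gpath M;
  fmor_r : forall l, rmap (fmor l) = fobj (rmap l);
  fmor_s : forall l, smap (fmor l) = fobj (smap l);
  fmor_id : forall v, fmor (idp v) = idp (fobj v);
  fmor_comp : forall l m, smap l = rmap m ->
    fmor (pcomp l m) = pcomp (fmor l) (fmor m);
  fmor_deg : forall l, deg (fmor l) = deg l
}.

Definition opath := {pq : deg2 * deg2 | le2 pq.1 pq.2}.

Lemma le2_refl p : le2 p p.
Proof. by rewrite /le2 !leqnn. Qed.

Lemma le2_trans q p t : le2 p q -> le2 q t -> le2 p t.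
Proof.
move=> /andP[a b] /andP[c d].
by rewrite /le2 (leq_trans a c) (leq_trans b d).
Qed.

Definition oid (p : deg2) : opath := exist _ (p, p) (le2_refl p).

(* The morphism (p, q) of Omega_2, meaningful when p <= q. *)
Definition om (p q : deg2) : opath := insubd (oid p) (p, q).

Definition ocomp (f g : opath) : opath := insubd f ((val f).1, (val g).2).

Definition odeg (f : opath) : deg2 :=
  ((val f).2.1 - (val f).1.1, (val f).2.2 - (val f).1.2)%N.

Lemma val_om p q : le2 p q -> val (om p q) = (p, q).
Proof. by move=> h; rewrite /om val_insubd h. Qed.

Lemma val_ocomp f g : (val f).2 = (val g).1 ->
  val (ocomp f g) = ((val f).1, (val g).2).
Proof.
move=> e; rewrite /ocomp val_insubd.
suff -> : le2 (val f).1 (val g).2 by [].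
by apply: le2_trans (valP f) _; rewrite e; exact: (valP g).
Qed.

Lemma deg2E (m n : deg2) : m.1 = n.1 -> m.2 = n.2 -> m = n.
Proof. by case: m n => [? ?] [? ?] /= -> ->. Qed.

Lemma odegK (f : opath) : (val f).1 + odeg f = (val f).2.
Proof. by have /andP[a b] := valP f; apply: deg2E; exact: subnKC. Qed.

Lemma addd_inj (p : deg2) : injective (+%R p).
Proof.
move=> m n e; apply: deg2E; [move: (congr1 fst e)|move: (congr1 snd e)].
  exact: addnI.
exact: addnI.
Qed.

Lemma le2_addr (p n : deg2) : le2 p (p + n).
Proof. by apply/andP; split; exact: leq_addr. Qed.

Lemma opathE (f g : opath) : (val f).1 = (val g).1 -> odeg f = odeg g -> f = g.
Proof.
move=> e d; apply: val_inj; move: (odegK f) (odegK g); rewrite e d => ->.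
by move: e; case: (val f) (val g) => [? ?] [? ?] /= -> ->.
Qed.

Lemma odeg_om p n : odeg (om p (p + n)) = n.
Proof.
by apply: (@addd_inj p); have := odegK (om p (p + n)); rewrite val_om ?le2_addr.
Qed.

Lemma Omega2_factorisation (l : opath) (m n : deg2) : odeg l = m + n ->
  exists! mn : opath * opath,
    [/\ odeg mn.1 = m, odeg mn.2 = n, (val mn.1).2 = (val mn.2).1
      & l = ocomp mn.1 mn.2].
Proof.
move=> dl; set p := (val l).1.
have e1' : val (om p (p + m)) = (p, p + m) by rewrite val_om ?le2_addr.
have e2' : val (om (p + m) (p + m + n)) = (p + m, p + m + n)
  by rewrite val_om ?le2_addr.
have lq : (val l).2 = p + m + n by rewrite -odegK dl addrA.
exists (om p (p + m), om (p + m) (p + m + n)); split => [|[f g]] /=.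
  split; rewrite ?odeg_om ?e1' ?e2' //.
  apply: val_inj; rewrite val_ocomp ?e1' ?e2' //=.
  by rewrite -lq -surjective_pairing.
case=> df dg e lE; have fp : (val f).1 = p by rewrite /p lE val_ocomp.
have fE : om p (p + m) = f by apply: opathE; rewrite ?e1' ?odeg_om.
suff -> : om (p + m) (p + m + n) = g by rewrite fE.
by apply: opathE; rewrite ?odeg_om // e2' -e -fE e1'.
Qed.

Definition Omega2 : twoGraph.
Proof.
refine (@TwoGraph deg2 opath (fun f => (val f).1) (fun f => (val f).2)
  oid ocomp odeg _ _ _ _ _ _ _ _ _ Omega2_factorisation) => //; rewrite /=.
- by move=> l m e; rewrite val_ocomp.
- by move=> l m e; rewrite val_ocomp.
- by move=> l; apply: val_inj; rewrite val_ocomp //= -surjective_pairing.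
- by move=> l; apply: val_inj; rewrite val_ocomp //= -surjective_pairing.
- by move=> l m n e f; apply: val_inj; rewrite !val_ocomp //= ?val_ocomp.
- by move=> v; apply: deg2E; exact: subnn.
- move=> l m e; apply: (@addd_inj (val l).1).
  have <- : (val (ocomp l m)).1 = (val l).1 by rewrite val_ocomp.
  by rewrite odegK val_ocomp //= addrA odegK e odegK.
Defined.

Definition infpath (L : twoGraph) := tgFunctor Omega2 L.
HB.instance Definition _ L := gen_eqMixin (infpath L).
HB.instance Definition _ L := gen_choiceMixin (infpath L).

Section InfinitePaths.
Variable L : twoGraph.
Implicit Types (x y : infpath L) (l : gpath L) (p q n : deg2).

(* x(n) and x(p, q) *)
Definition ipv x n : vert L := fobj x n.
Definition ipm x p q : gpath L := fmor x (om p q).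

Definition is_prepend l x y : Prop :=
  ipm y 0 (deg l) = l /\
  forall p q, le2 p q -> ipm y (deg l + p) (deg l + q) = ipm x p q.

(* The infinite path l x, meaningful when [smap l = ipv x 0]
   (see [prependP] and [prepend_unique]). *)
Definition prepend l x : infpath L := xget x [set y | is_prepend l x y].

End InfinitePaths.

Lemma tgFunctor_ext (L M : twoGraph) (F G : tgFunctor L M) :
  fmor F =1 fmor G -> F = G.
Proof.
case: F G => [fo fm ? ? fid ? ?] [go gm ? ? gid ? ?] /= /funext mE.
have oE : fo = go.
  by apply/funext => v; rewrite -[LHS]rmap_id -fid mE gid rmap_id.
by subst; f_equal; exact: Prop_irrelevance.
Qed.

Section PrependTheory.
Variable L : twoGraph.
Implicit Types (x y : infpath L) (a b c l w u : gpath L) (p q t n : deg2).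

Lemma factor_uniq a b a' b' : smap a = rmap b -> smap a' = rmap b' ->
  deg a = deg a' -> pcomp a b = pcomp a' b' -> a = a' /\ b = b'.
Proof.
move=> h h' d e.
have db : deg b = deg b'.
  by apply: (@addd_inj (deg a)); rewrite -deg_comp // e deg_comp // d.
have [m [_ U]] := factorisation (deg_comp h).
have [<- <-] : (a, b) = (a', b'); last by [].
by rewrite -(U (a, b)) //; apply: U.
Qed.

Lemma deg0_id a : deg a = 0 -> a = idp (rmap a).
Proof.
move=> d.
have [] // := @factor_uniq a (idp (smap a)) (idp (rmap a)) a;
  by rewrite ?rmap_id ?smap_id ?deg_id ?comp_idl ?comp_idr.
Qed.

Definition seg w p q b : Prop := exists a c,
  [/\ smap a = rmap b, smap b = rmap c, w = pcomp a (pcomp b c), deg a = p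
    & p + deg b = q].

Lemma le2_split p q : le2 p q -> exists n, q = p + n.
Proof. by move=> h; exists (odeg (om p q)); have := odegK (om p q); rewrite val_om. Qed.

Lemma seg_exists w p q : le2 p q -> le2 q (deg w) -> exists b, seg w p q b.
Proof.
move=> /le2_split[m ->] /le2_split[n]; rewrite -addrA => d.
have [[a v] [[/= da dv h wE] _]] := factorisation d.
have [[b c] [[/= db dc k vE] _]] := factorisation dv.
exists b, a, c; split; rewrite ?da ?db -?vE //.
by rewrite h vE rmap_comp.
Qed.

Lemma seg_uniq w p q b b' : seg w p q b -> seg w p q b' -> b = b'.
Proof.
move=> [a [c [h k -> d e]]] [a' [c' [h' k' E d' e']]].
have [_ E'] : a = a' /\ pcomp b c = pcomp b' c'.
  by apply: factor_uniq E; rewrite ?rmap_comp ?d ?d'.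
have [] // := @factor_uniq b c b' c' => //.
by apply: (@addd_inj p); rewrite e e'.
Qed.

Lemma seg_comp w p q t b b' : seg w p q b -> seg w q t b' ->
  smap b = rmap b' /\ seg w p t (pcomp b b').
Proof.
move=> [a [c [h k wE d e]]] [a' [c' [h' k' E d' e']]].
have [aE cE] : pcomp a b = a' /\ c = pcomp b' c'.
  apply: factor_uniq; rewrite ?smap_comp ?rmap_comp ?deg_comp ?d ?d' //.
  by rewrite -pcompA // -wE.
have k2 : smap b = rmap b' by rewrite k cE rmap_comp.
split => //; exists a, c'; split; rewrite ?rmap_comp ?smap_comp //.
  by rewrite -pcompA // -cE.
by rewrite deg_comp // addrA e.
Qed.

Lemma seg_ext w p q b u : smap w = rmap u -> seg w p q b ->
  seg (pcomp w u) p q b.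
Proof.
move=> h [a [c [h1 h2 wE d e]]]; exists a, (pcomp c u).
have hc : smap c = rmap u by rewrite -h wE !smap_comp // rmap_comp.
by split; rewrite ?rmap_comp // wE pcompA // -!pcompA // ?smap_comp ?rmap_comp.
Qed.

Lemma ipm_r x p q : le2 p q -> rmap (ipm x p q) = ipv x p.
Proof. by move=> h; rewrite /ipm fmor_r /= val_om. Qed.

Lemma ipm_s x p q : le2 p q -> smap (ipm x p q) = ipv x q.
Proof. by move=> h; rewrite /ipm fmor_s /= val_om. Qed.

Lemma ipm_deg x p n : deg (ipm x p (p + n)) = n.
Proof. by rewrite /ipm fmor_deg /= odeg_om. Qed.

Lemma ipm_comp x p q t : le2 p q -> le2 q t ->
  pcomp (ipm x p q) (ipm x q t) = ipm x p t.
Proof.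
move=> h k; rewrite /ipm -fmor_comp /= ?val_om //; congr fmor.
by apply: val_inj; rewrite val_ocomp ?val_om // (le2_trans h k).
Qed.

Lemma om_val (f : opath) : om (val f).1 (val f).2 = f.
Proof. by apply: val_inj; rewrite val_om -?surjective_pairing //; exact: (valP f). Qed.

Lemma le2_0 p : le2 0 p.
Proof. by rewrite -[p]add0r le2_addr. Qed.

Lemma le2_addl p n : le2 p (n + p).
Proof. by rewrite addrC le2_addr. Qed.

Lemma le2_add2l n p q : le2 p q -> le2 (n + p) (n + q).
Proof. by move=> /le2_split[m ->]; rewrite addrA le2_addr. Qed.

Section Construction.
Variables (l : gpath L) (x : infpath L).
Hypothesis lx : smap l = ipv x 0.

Let w n := pcomp l (ipm x 0 n).

Let lxn n : smap l = rmap (ipm x 0 n).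
Proof. by rewrite ipm_r ?le2_0. Qed.

Let deg_w n : deg (w n) = deg l + n.
Proof. by rewrite deg_comp // -{1}[n]add0r ipm_deg. Qed.

Let w_mono m n p q b : le2 m n -> seg (w m) p q b -> seg (w n) p q b.
Proof.
move=> h /(seg_ext (u := ipm x m n)); rewrite /w -pcompA ?ipm_comp ?le2_0 //.
  by apply; rewrite smap_comp // ipm_r // ipm_s ?le2_0.
by rewrite ipm_r // ipm_s ?le2_0.
Qed.

Let yex (f : opath) : exists b, seg (w (val f).2) (val f).1 (val f).2 b.
Proof. by apply: seg_exists; [exact: (valP f)|rewrite deg_w le2_addl]. Qed.

Let ymor f := sval (cid (yex f)).

Let ymorP f n : le2 (val f).2 n -> seg (w n) (val f).1 (val f).2 (ymor f).
Proof. by move=> h; apply: w_mono h _; rewrite /ymor; case: cid. Qed.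

Let ymorE f n b : le2 (val f).2 n -> seg (w n) (val f).1 (val f).2 b ->
  ymor f = b.
Proof. by move=> h; exact: seg_uniq (ymorP h). Qed.

Let yobj p := rmap (ymor (oid p)).

Let yid p : ymor (oid p) = idp (yobj p).
Proof.
apply: deg0_id; have [a [c [_ _ _ _ e]]] := ymorP (f := oid p) (le2_refl _).
by apply: (@addd_inj p); rewrite e addr0.
Qed.

Let yr f : rmap (ymor f) = yobj (val f).1.
Proof.
have h := ymorP (f := oid (val f).1) (valP f).
have [<- _] := seg_comp h (ymorP (le2_refl _)).
by rewrite yid smap_id.
Qed.

Let ys f : smap (ymor f) = yobj (val f).2.
Proof.
have h := ymorP (f := oid (val f).2) (le2_refl _).
by have [-> _] := seg_comp (ymorP (f := f) (le2_refl _)) h.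
Qed.

Let ycomp (f g : opath) : (val f).2 = (val g).1 ->
  ymor (ocomp f g) = pcomp (ymor f) (ymor g).
Proof.
move=> e; apply: (@ymorE _ (val g).2); rewrite val_ocomp //= ?le2_refl //.
have fg : le2 (val f).2 (val g).2 by rewrite e; exact: (valP g).
have /seg_comp := ymorP fg; rewrite e => h.
by have [_] := h _ _ (ymorP (le2_refl _)).
Qed.

Let ydeg f : deg (ymor f) = odeg f.
Proof.
have [a [c [_ _ _ _ e]]] := ymorP (f := f) (le2_refl _).
by apply: (@addd_inj (val f).1); rewrite e odegK.
Qed.

Lemma prepend_exists : exists y, is_prepend l x y.
Proof.
exists (@TgFunctor Omega2 L yobj ymor yr ys yid ycomp ydeg); split=> [|p q h].
  apply: (@ymorE _ (deg l)); rewrite val_om ?le2_0 ?le2_refl //=.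
  exists (idp (rmap l)), (ipm x 0 (deg l)).
  split; rewrite ?smap_id ?deg_id ?add0r //.
  by rewrite -[l in RHS]/l -(rmap_comp (lxn (deg l))) comp_idl.
apply: (@ymorE _ (deg l + q)); rewrite val_om ?le2_refl ?le2_add2l //=.
apply: (w_mono (m := q)); first exact: le2_addl.
have lp := lxn p.
exists (pcomp l (ipm x 0 p)), (idp (ipv x q)); split.
- by rewrite smap_comp // ipm_s ?le2_0 // ipm_r.
- by rewrite rmap_id ipm_s.
- rewrite -(ipm_s x h) comp_idr -pcompA ?ipm_comp ?le2_0 //.
  by rewrite ipm_s ?le2_0 // ipm_r.
- by rewrite deg_comp // -{1}[p]add0r ipm_deg.
- by have [n ->] := le2_split h; rewrite ipm_deg addrA.
Qed.

Lemma prepend_unique y z : is_prepend l x y -> is_prepend l x z -> y = z.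
Proof.
suff key y' f : is_prepend l x y' ->
    seg (w (val f).2) (val f).1 (val f).2 (fmor y' f).
  by move=> hy hz; apply: tgFunctor_ext => f; apply: seg_uniq (key _ _ hy) (key _ _ hz).
move=> [y0 yp]; have q0 := le2_0 (val f).2; have fle := valP f.
have wE : w (val f).2 = ipm y' 0 (deg l + (val f).2).
  by rewrite /w -(yp _ _ q0) addr0 -[X in pcomp X _]y0 ipm_comp ?le2_0 ?le2_addr.
have qE := le2_addl (val f).2 (deg l).
have fE : fmor y' f = ipm y' (val f).1 (val f).2 by rewrite /ipm om_val.
exists (ipm y' 0 (val f).1), (ipm y' (val f).2 (deg l + (val f).2)).
rewrite fE; split; rewrite ?ipm_s ?ipm_r ?le2_0 //.
- by rewrite !ipm_comp ?le2_0 // (le2_trans fle qE).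
- by rewrite -{1}[(val f).1]add0r ipm_deg.
- by have [n ->] := le2_split fle; rewrite ipm_deg.
Qed.

Lemma prependP : is_prepend l x (prepend l x).
Proof. by have [y hy] := prepend_exists; apply: (xgetI x hy). Qed.

End Construction.
End PrependTheory.

Section Conditions.
Variable L : twoGraph.

(* v Lambda^n *)
Definition paths_from (v : vert L) (n : deg2) : set (gpath L) :=
  [set l | rmap l = v /\ deg l = n].

Definition row_finite : Prop := forall v n, finite_set (paths_from v n).

Definition no_sources : Prop := forall v n, paths_from v n !=set0.

Definition disjoint_cycles_red : Prop :=
  [/\ forall v : vert L, exists! f : gpath L, deg f = e2 /\ rmap f = v,
      forall v : vert L, exists! f : gpath L, deg f = e2 /\ smap f = v
    & forall v : vert L, exists (k : nat) (l : gpath L),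
        [/\ (0 < k)%N, deg l = (0%N, k), rmap l = v & smap l = v]].

(* The partition of the vertices into the V_n is given by its level function:
   V_n = [set v | lev v = n]. *)
Definition rank2_bratteli : Prop :=
  [/\ row_finite, no_sources, disjoint_cycles_red
    & exists lev : vert L -> nat,
      [/\ forall n, finite_set [set v | lev v = n]
                    /\ [set v | lev v = n] !=set0,
          forall e : gpath L, deg e = e1 -> lev (smap e) = (lev (rmap e)).+1,
          forall v, (1 <= lev v)%N ->
            exists e : gpath L, deg e = e1 /\ smap e = v
        & forall f : gpath L, deg f = e2 -> lev (smap f) = lev (rmap f)]].

Definition cofinal : Prop :=
  forall (x : infpath L) (v : vert L),
    exists n : deg2, exists l : gpath L, rmap l = v /\ smap l = ipv x n.

Definition aperiodic : Prop :=
  forall v : vert L, exists x : infpath L, ipv x 0 = v /\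
    forall a b : gpath L, a <> b -> smap a = v -> smap b = v ->
      prepend a x <> prepend b x.

End Conditions.

Reserved Notation "x ** y" (at level 40, left associativity).

HB.mixin Record Lmodule_isNuAlgebra (K : fieldType) A of GRing.Lmodule K A := {
  nmul : A -> A -> A;
  nmulA : associative nmul;
  nmulDl : left_distributive nmul +%R;
  nmulDr : right_distributive nmul +%R;
  nmulZl : forall (c : K) (a b : A), nmul (c *: a) b = c *: nmul a b;
  nmulZr : forall (c : K) (a b : A), nmul a (c *: b) = c *: nmul a b
}.

#[short(type="nuAlgType")]
HB.structure Definition NuAlgebra (K : fieldType) :=
  {A of GRing.Lmodule K A & Lmodule_isNuAlgebra K A}.

Notation "x ** y" := (nmul x y) : ring_scope.

Definition nuhom (K : fieldType) (A B : nuAlgType K) (f : A -> B) : Prop :=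
  linear f /\ {morph f : x y / x ** y}.

Section RingNotions.
Variables (K : fieldType) (A : nuAlgType K).

Definition additive_subgroup (I : set A) : Prop :=
  I 0 /\ forall a b, I a -> I b -> I (a - b).

Definition right_ideal (I : set A) : Prop :=
  additive_subgroup I /\ forall a b, I a -> I (a ** b).

Definition two_sided_ideal (I : set A) : Prop :=
  right_ideal I /\ forall a b, I b -> I (a ** b).

Definition simple_ring : Prop :=
  (exists a b : A, a ** b <> 0) /\
  forall I : set A, two_sided_ideal I -> I = [set 0] \/ I = setT.

Definition idempotent_elt (p : A) : Prop := p ** p = p.

Definition infinite_idempotent (p : A) : Prop :=
  idempotent_elt p /\
  exists p1 p2 x y : A,
    [/\ [/\ idempotent_elt p1, p1 <> 0, idempotent_elt p2 & p2 <> 0],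
        p1 ** p2 = 0 /\ p2 ** p1 = 0,
        (exists a, x = p ** a ** p1) /\ (exists b, y = p1 ** b ** p)
      & [/\ p = p1 + p2, p = x ** y & p1 = y ** x]].

(* The notion is only used for simple rings. *)
Definition purely_infinite : Prop :=
  forall I : set A, right_ideal I -> I <> [set 0] ->
    exists p, I p /\ infinite_idempotent p.

(* [phi] is an isomorphism onto the product of the M_{k i + 1}(K), with
   componentwise operations. *)
Definition matricial : Prop :=
  exists (n : nat) (k : 'I_n -> nat)
         (phi : A -> forall i : 'I_n, 'M[K]_((k i).+1)),
    [/\ bijective phi,
        forall (c : K) a b i, phi (c *: a + b) i = c *: phi a i + phi b i
      & forall a b i, phi (a ** b) i = phi a i *m phi b i].

End RingNotions.

Record dirSystem (K : fieldType) := DirSystem {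
  ds_disp : Order.disp_t;
  ds_index : preorderType ds_disp;
  ds_obj : ds_index -> nuAlgType K;
  ds_map : forall i j : ds_index, ds_obj i -> ds_obj j;
  ds_inhabited : inhabited ds_index;
  ds_directed : forall i j : ds_index, exists k, (i <= k)%O && (j <= k)%O;
  ds_hom : forall i j, (i <= j)%O -> nuhom (@ds_map i j);
  ds_map_id : forall i, @ds_map i i =1 id;
  ds_map_comp : forall i j k, (i <= j)%O -> (j <= k)%O ->
    @ds_map j k \o @ds_map i j =1 @ds_map i k
}.

Section DirectLimit.
Variables (K : fieldType) (D : dirSystem K).

Definition cocone (A : nuAlgType K) (psi : forall i : ds_index D, ds_obj i -> A) : Prop :=
  (forall i, nuhom (psi i)) /\
  forall i j, (i <= j)%O -> psi j \o @ds_map K D i j =1 psi i.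

Definition direct_limit (A : nuAlgType K) (psi : forall i : ds_index D, ds_obj i -> A) :
    Prop :=
  cocone psi /\
  forall (B : nuAlgType K) (chi : forall i : ds_index D, ds_obj i -> B), cocone chi ->
    exists! h : A -> B, nuhom h /\ forall i, h \o psi i =1 chi i.

End DirectLimit.

Definition locally_matricial (K : fieldType) (A : nuAlgType K) : Prop :=
  exists (D : dirSystem K) (psi : forall i : ds_index D, ds_obj i -> A),
    (forall i : ds_index D, matricial (ds_obj i)) /\ direct_limit psi.

(* Lambda^{<>0} *)
Notation npath L := {l : gpath L | deg l != 0}.

(* [p], [s], [t] are the families p_v, s_lambda, s_{lambda^*}. *)
Record KP_family (K : fieldType) (L : twoGraph) (A : nuAlgType K)
    (p : vert L -> A) (s t : npath L -> A) : Prop := KPFamily {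
  KP1 : forall v w, p v ** p w = if v == w then p v else 0;
  KP2s : forall l m n : npath L, smap (val l) = rmap (val m) ->
    val n = pcomp (val l) (val m) -> s l ** s m = s n;
  KP2t : forall l m n : npath L, smap (val l) = rmap (val m) ->
    val n = pcomp (val l) (val m) -> t m ** t l = t n;
  KP2rs : forall l, p (rmap (val l)) ** s l = s l;
  KP2ss : forall l, s l ** p (smap (val l)) = s l;
  KP2st : forall l, p (smap (val l)) ** t l = t l;
  KP2rt : forall l, t l ** p (rmap (val l)) = t l;
  KP3 : forall l m, deg (val l) = deg (val m) ->
    t l ** s m = if l == m then p (smap (val l)) else 0;
  KP4 : forall v n, n != 0 ->
    p v = \sum_(l \in [set l : npath L | paths_from v n (val l)]) s l ** t l
}.

Inductive kterm (K : fieldType) (L : twoGraph) : Type :=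
| KP_v of vert L
| KP_s of npath L
| KP_t of npath L
| KP_zero
| KP_opp of kterm K L
| KP_add of kterm K L & kterm K L
| KP_scale of K & kterm K L
| KP_mul of kterm K L & kterm K L.
Arguments KP_v {K L}.
Arguments KP_s {K L}.
Arguments KP_t {K L}.
Arguments KP_zero {K L}.

HB.instance Definition _ K L := gen_eqMixin (kterm K L).
HB.instance Definition _ K L := gen_choiceMixin (kterm K L).

Fixpoint keval (K : fieldType) (L : twoGraph) (A : nuAlgType K)
    (p : vert L -> A) (s t : npath L -> A) (u : kterm K L) : A :=
  match u with
  | KP_v v => p v
  | KP_s l => s l
  | KP_t l => t l
  | KP_zero => 0
  | KP_opp u => - keval p s t u
  | KP_add u v => keval p s t u + keval p s t v
  | KP_scale c u => c *: keval p s t u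
  | KP_mul u v => keval p s t u ** keval p s t v
  end.

Section KumjianPask.
Variables (K : fieldType) (L : twoGraph).

(* Two expressions are identified when they agree in every K-algebra carrying
   a family satisfying the relations; the quotient is the universal such
   algebra, see [KP_is_family] and [KP_universal]. *)
Definition keqP (u v : kterm K L) : Prop :=
  forall (A : nuAlgType K) (p : vert L -> A) (s t : npath L -> A),
    KP_family p s t -> keval p s t u = keval p s t v.

Definition keq (u v : kterm K L) : bool := `[< keqP u v >].

Lemma keq_refl : reflexive keq.
Proof. by move=> u; apply/asboolP. Qed.

Lemma keq_sym : symmetric keq.
Proof.
by move=> u v; apply/asboolP/asboolP => h A p s t f; rewrite (h _ _ _ _ f).
Qed.

Lemma keq_trans : transitive keq.
Proof.
move=> v u w /asboolP h /asboolP h'; apply/asboolP => A p s t f.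
by rewrite (h _ _ _ _ f) (h' _ _ _ _ f).
Qed.

Canonical keq_equiv := EquivRel keq keq_refl keq_sym keq_trans.

Definition KP := {eq_quot keq_equiv}%qT.
HB.instance Definition _ := Choice.on KP.
HB.instance Definition _ := EqQuotient.on KP.

Definition kpi (u : kterm K L) : KP := (\pi_KP u)%qT.

Lemma kpi_eqP u v : kpi u = kpi v <-> keqP u v.
Proof.
split => [/eqP|h]; first by rewrite /kpi piE => /asboolP.
by apply/eqP; rewrite /kpi piE; apply/asboolP.
Qed.

Lemma kpi_repr (a : KP) : kpi (repr a) = a.
Proof. exact: reprK. Qed.

Lemma kpiK u A p s t : @KP_family K L A p s t ->
  keval p s t (repr (kpi u)) = keval p s t u.
Proof. by move: A p s t; apply/kpi_eqP; rewrite kpi_repr. Qed.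

Definition kp_zero : KP := kpi KP_zero.
Definition kp_opp (a : KP) : KP := kpi (KP_opp (repr a)).
Definition kp_add (a b : KP) : KP := kpi (KP_add (repr a) (repr b)).
Definition kp_scale (c : K) (a : KP) : KP := kpi (KP_scale c (repr a)).
Definition kp_mul (a b : KP) : KP := kpi (KP_mul (repr a) (repr b)).

Lemma KP_ext (a b : KP) :
  (forall A p s t, @KP_family K L A p s t ->
     keval p s t (repr a) = keval p s t (repr b)) -> a = b.
Proof. by move=> h; rewrite -(kpi_repr a) -(kpi_repr b); apply/kpi_eqP. Qed.

Ltac kp_solve fam := hnf; intros; apply: KP_ext; intros ? ? ? ? fam;
  rewrite ?(kpiK _ fam) /= ?(kpiK _ fam) /=.

Lemma kp_addA : associative kp_add.
Proof. by kp_solve fam; rewrite addrA. Qed.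
Lemma kp_addC : commutative kp_add.
Proof. by kp_solve fam; rewrite addrC. Qed.
Lemma kp_add0 : left_id kp_zero kp_add.
Proof. by kp_solve fam; rewrite add0r. Qed.
Lemma kp_addN : left_inverse kp_zero kp_opp kp_add.
Proof. by kp_solve fam; rewrite addNr. Qed.

HB.instance Definition _ :=
  GRing.isZmodule.Build KP kp_addA kp_addC kp_add0 kp_addN.

Lemma kp_scaleA c d a : kp_scale c (kp_scale d a) = kp_scale (c * d) a.
Proof. by kp_solve fam; rewrite scalerA. Qed.
Lemma kp_scale1 : left_id 1 kp_scale.
Proof. by kp_solve fam; rewrite scale1r. Qed.
Lemma kp_scaleDr : right_distributive kp_scale +%R.
Proof. by kp_solve fam; rewrite scalerDr. Qed.
Lemma kp_scaleDl a : {morph kp_scale^~ a : c d / c + d}.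
Proof. by kp_solve fam; rewrite scalerDl. Qed.

HB.instance Definition _ := GRing.Zmodule_isLmodule.Build K KP
  kp_scaleA kp_scale1 kp_scaleDr kp_scaleDl.

Lemma kp_mulA : associative kp_mul.
Proof. by kp_solve fam; rewrite nmulA. Qed.
Lemma kp_mulDl : left_distributive kp_mul +%R.
Proof. by kp_solve fam; rewrite nmulDl. Qed.
Lemma kp_mulDr : right_distributive kp_mul +%R.
Proof. by kp_solve fam; rewrite nmulDr. Qed.
Lemma kp_mulZl (c : K) (a b : KP) : kp_mul (c *: a) b = c *: kp_mul a b.
Proof. by kp_solve fam; rewrite nmulZl. Qed.
Lemma kp_mulZr (c : K) (a b : KP) : kp_mul a (c *: b) = c *: kp_mul a b.
Proof. by kp_solve fam; rewrite nmulZr. Qed.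

HB.instance Definition _ := Lmodule_isNuAlgebra.Build K KP
  kp_mulA kp_mulDl kp_mulDr kp_mulZl kp_mulZr.

Definition kp_v (v : vert L) : KP := kpi (KP_v v).
Definition kp_s (l : npath L) : KP := kpi (KP_s l).
Definition kp_t (l : npath L) : KP := kpi (KP_t l).

Definition KP_lift (A : nuAlgType K) (p : vert L -> A) (s t : npath L -> A)
  (a : KP) : A := keval p s t (repr a).

Lemma KP_lift_hom A p s t : @KP_family K L A p s t -> nuhom (KP_lift p s t).
Proof.
move=> fam; split => [c a b|a b]; rewrite /KP_lift (kpiK _ fam) //=.
by rewrite (kpiK _ fam).
Qed.

Lemma KP_is_family : row_finite L -> KP_family kp_v kp_s kp_t.
Proof.
move=> rf; split.
- move=> v w; kp_solve fam; rewrite (KP1 fam).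
  by case: ifP => _; rewrite (kpiK _ fam).
- by move=> l m n h e; kp_solve fam; rewrite (KP2s fam h e).
- by move=> l m n h e; kp_solve fam; rewrite (KP2t fam h e).
- by kp_solve fam; rewrite (KP2rs fam).
- by kp_solve fam; rewrite (KP2ss fam).
- by kp_solve fam; rewrite (KP2st fam).
- by kp_solve fam; rewrite (KP2rt fam).
- move=> l m h; kp_solve fam; rewrite (KP3 fam h).
  by case: ifP => _; rewrite (kpiK _ fam).
move=> v n n0.
have fin : finite_set [set l : npath L | paths_from v n (val l)].
  by apply: (finite_preimage _ (rf v n)) => l m _ _; exact: val_inj.
rewrite fsbig_finite //.
apply: KP_ext => A p s t fam; rewrite (kpiK _ fam) /= (KP4 fam v n0).
rewrite fsbig_finite //.
elim: (finmap.enum_fset _) => [|l e IH].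
  by rewrite !big_nil (kpiK _ fam).
by rewrite !big_cons (kpiK _ fam) /= -IH !(kpiK _ fam) /= !(kpiK _ fam).
Qed.

Lemma KP_universal (A : nuAlgType K) (p : vert L -> A) (s t : npath L -> A) :
  KP_family p s t ->
  exists! h : KP -> A,
    [/\ nuhom h, h \o kp_v = p, h \o kp_s = s & h \o kp_t = t].
Proof.
move=> fam; exists (KP_lift p s t); split.
  split; first exact: KP_lift_hom.
  - by apply/funext => v; rewrite /= /KP_lift (kpiK _ fam).
  - by apply/funext => v; rewrite /= /KP_lift (kpiK _ fam).
  - by apply/funext => v; rewrite /= /KP_lift (kpiK _ fam).
move=> h [[hl hm] <- <- <-]; apply/funext => a.
rewrite -[in RHS](kpi_repr a) /KP_lift.
have [h0 hN hD hZ] : [/\ h 0 = 0, {morph h : x / - x},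
    {morph h : x y / x + y} & forall c, {morph h : x / c *: x}].
  have hD : {morph h : x y / x + y} by move=> x y; rewrite -[x]scale1r hl !scale1r.
  have h0 : h 0 = 0 by apply: (addIr (h 0)); rewrite -hD !add0r.
  have hZ c : {morph h : x / c *: x} by move=> x; rewrite -[_ *: x]addr0 hl h0 addr0.
  by split=> // x; rewrite -!scaleN1r hZ.
elim: (repr a) => [v|l|l||u IH|u IHu w IHw|c u IH|u IHu w IHw] //=.
- by rewrite IH -hN; congr h; kp_solve f.
- by rewrite IHu IHw -hD; congr h; kp_solve f.
- by rewrite IH -hZ; congr h; kp_solve f.
- by rewrite IHu IHw -hm; congr h; kp_solve f.
Qed.

End KumjianPask.

(* Main.v *)
(** Write S_l and T_l for the generators attached to a path l and to its ghost.

    Simplicity: if a <> 0 then a S_l is a nonzero combination of distinct S_b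
    for some l.  An aperiodic infinite path at s(l), truncated far enough to
    separate the paths b, isolates one of the coefficients, so that the ideal
    of a contains a vertex.  If the ideal missed a vertex v, then one could
    extend v step by step to an infinite path avoiding the ideal, against
    cofinality.

    Not purely infinite: let P_N be the finite set of blue paths with source
    in V_N.  Moving red edges to the end of a path lets Lambda act on P_N by
    partial injections, hence by matrices; the relation (KP4) holds at v only
    for large N, so this represents KP in sequences of matrices modulo eventual
    equality.  By simplicity the representation is faithful, and ranks exclude
    infinite idempotents.  It also shows that the vertices are nonzero in KP.

    Not locally matricial: every element of a locally matricial algebra is
    algebraic over K, whereas S_l for a red cycle l is not. *)

From HB Require Import structures.
From mathcomp Require Import all_boot all_order all_algebra.
From mathcomp Require Import finmap all_classical zify.
Require Import Defs.

Set Implicit Arguments.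
Unset Strict Implicit.
Unset Printing Implicit Defensive.

Import Order.TTheory GRing.Theory.
Local Open Scope classical_set_scope.
Local Open Scope ring_scope.

(** * Non-unital algebras, their homomorphisms and ideals *)

Section NonunitalAlgebra.
Variables (K : fieldType) (A : nuAlgType K).
Implicit Types a b : A.

Lemma nmul0r b : (0 : A) ** b = 0.
Proof. by rewrite -(scale0r (0 : A)) nmulZl !scale0r. Qed.

Lemma nmulr0 a : a ** (0 : A) = 0.
Proof. by rewrite -(scale0r (0 : A)) nmulZr !scale0r. Qed.

Lemma nmul_sumr (I : Type) (r : seq I) (F : I -> A) a :
  a ** (\sum_(i <- r) F i) = \sum_(i <- r) a ** F i.
Proof.
elim: r => [|i r IH]; first by rewrite !big_nil nmulr0.
by rewrite !big_cons nmulDr IH.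
Qed.

Lemma nmul_suml (I : Type) (r : seq I) (F : I -> A) a :
  (\sum_(i <- r) F i) ** a = \sum_(i <- r) F i ** a.
Proof.
elim: r => [|i r IH]; first by rewrite !big_nil nmul0r.
by rewrite !big_cons nmulDl IH.
Qed.

End NonunitalAlgebra.

Section NonunitalHom.
Variables (K : fieldType) (A B : nuAlgType K) (f : A -> B).
Hypothesis hf : nuhom f.

Lemma nuhomM : {morph f : a b / a ** b}. Proof. by case: hf. Qed.

Lemma nuhomD : {morph f : a b / a + b}.
Proof. by case: hf => hl _ a b; rewrite -[a]scale1r hl !scale1r. Qed.

Lemma nuhom0 : f 0 = 0.
Proof. by apply: (addIr (f 0)); rewrite -nuhomD !add0r. Qed.

Lemma nuhomZ c : {morph f : a / c *: a}.
Proof. by case: hf => hl _ a; rewrite -[_ *: a]addr0 hl nuhom0 addr0. Qed.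

Lemma nuhomN : {morph f : a / - a}.
Proof. by move=> a; rewrite -scaleN1r nuhomZ scaleN1r. Qed.

Lemma nuhomB : {morph f : a b / a - b}.
Proof. by move=> a b; rewrite nuhomD nuhomN. Qed.

Lemma nuhom_sum (I : Type) (r : seq I) (F : I -> A) :
  f (\sum_(i <- r) F i) = \sum_(i <- r) f (F i).
Proof.
elim: r => [|i r IH]; first by rewrite !big_nil nuhom0.
by rewrite !big_cons nuhomD IH.
Qed.

End NonunitalHom.

Lemma nuhom_comp (K : fieldType) (A B C : nuAlgType K) (f : A -> B) (g : B -> C) :
  nuhom f -> nuhom g -> nuhom (g \o f).
Proof.
move=> [fl fm] [gl gm]; split=> [c a b|a b] /=; first by rewrite fl gl.
by rewrite fm gm.
Qed.

Section Ideals.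
Variables (K : fieldType) (A : nuAlgType K) (I : set A).
Hypothesis hI : two_sided_ideal I.

Lemma ideal0 : I 0. Proof. by case: hI => -[[]]. Qed.

Lemma idealD a b : I a -> I b -> I (a + b).
Proof.
case: hI => -[[I0 IB] _] _ Ia Ib; rewrite -[b]opprK; apply: (IB) => //.
by rewrite -sub0r; apply: IB.
Qed.

Lemma idealMr a b : I a -> I (a ** b).
Proof. by case: hI => -[_ h] _; exact: h. Qed.

Lemma idealMl a b : I b -> I (a ** b).
Proof. by case: hI => _; exact. Qed.

Lemma ideal_sum (J : eqType) (r : seq J) (F : J -> A) :
  (forall i, i \in r -> I (F i)) -> I (\sum_(i <- r) F i).
Proof.
by move=> h; rewrite big_seq; elim/big_ind: _ => //; [exact: ideal0|exact: idealD].
Qed.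

End Ideals.

(** * Generators indexed by all paths of a Kumjian-Pask family *)

Section Families.
Variables (K : fieldType) (L : twoGraph) (A : nuAlgType K).
Variables (p : vert L -> A) (s t : npath L -> A).
Implicit Types l m a b : gpath L.

(** [insub] fails exactly on the paths of degree 0; these are vertices and receive p_v. The
    relations then hold for all paths without separating off degree 0. *)
Definition path_s l : A := if insub l is Some u then s u else p (rmap l).
Definition path_t l : A := if insub l is Some u then t u else p (rmap l).

Lemma path_s0 v : path_s (idp v) = p v.
Proof. by rewrite /path_s insubF ?deg_id ?eqxx ?rmap_id. Qed.

Lemma path_t0 v : path_t (idp v) = p v.
Proof. by rewrite /path_t insubF ?deg_id ?eqxx ?rmap_id. Qed.

Lemma path_s_val (u : npath L) : path_s (val u) = s u.
Proof. by rewrite /path_s valK. Qed.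

Lemma path_t_val (u : npath L) : path_t (val u) = t u.
Proof. by rewrite /path_t valK. Qed.

Lemma pathP l : (exists v, l = idp v) \/ (exists u : npath L, l = val u).
Proof.
have [d0|dn] := eqVneq (deg l) 0; first by left; exists (rmap l); exact: deg0_id.
by right; exists (exist (fun l : gpath L => is_true (deg l != 0)) l dn).
Qed.

Hypothesis fam : KP_family p s t.

Lemma path_s_r l : p (rmap l) ** path_s l = path_s l.
Proof.
have [[v ->]|[u ->]] := pathP l; last by rewrite path_s_val (KP2rs fam).
by rewrite path_s0 rmap_id (KP1 fam) eqxx.
Qed.

Lemma path_s_s l : path_s l ** p (smap l) = path_s l.
Proof.
have [[v ->]|[u ->]] := pathP l; last by rewrite path_s_val (KP2ss fam).
by rewrite path_s0 smap_id (KP1 fam) eqxx.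
Qed.

Lemma path_t_r l : path_t l ** p (rmap l) = path_t l.
Proof.
have [[v ->]|[u ->]] := pathP l; last by rewrite path_t_val (KP2rt fam).
by rewrite path_t0 rmap_id (KP1 fam) eqxx.
Qed.

Lemma path_t_s l : p (smap l) ** path_t l = path_t l.
Proof.
have [[v ->]|[u ->]] := pathP l; last by rewrite path_t_val (KP2st fam).
by rewrite path_t0 smap_id (KP1 fam) eqxx.
Qed.

Lemma pcomp_npath (u w : npath L) : smap (val u) = rmap (val w) ->
  exists n : npath L, val n = pcomp (val u) (val w).
Proof.
move=> h; suff nz : deg (pcomp (val u) (val w)) != 0.
  by exists (exist (fun l : gpath L => is_true (deg l != 0)) _ nz).
rewrite deg_comp //; apply: contra (valP u) => /eqP e; apply/eqP/deg2E.
  by move: (congr1 fst e) => /eqP; rewrite addn_eq0 => /andP[/eqP].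
by move: (congr1 snd e) => /eqP; rewrite addn_eq0 => /andP[/eqP].
Qed.

Lemma path_s_comp l m : smap l = rmap m ->
  path_s l ** path_s m = path_s (pcomp l m).
Proof.
have [[v ->]|[u ->]] := pathP l; rewrite ?smap_id => h.
  by rewrite path_s0 h comp_idl path_s_r.
have [[v e]|[w e]] := pathP m; move: h; rewrite e ?rmap_id => h.
  by rewrite path_s0 -h comp_idr path_s_s.
have [n en] := pcomp_npath h.
by rewrite !path_s_val -en path_s_val (KP2s fam h en).
Qed.

Lemma path_t_comp l m : smap l = rmap m ->
  path_t m ** path_t l = path_t (pcomp l m).
Proof.
have [[v ->]|[u ->]] := pathP l; rewrite ?smap_id => h.
  by rewrite path_t0 h comp_idl path_t_r.
have [[v e]|[w e]] := pathP m; move: h; rewrite e ?rmap_id => h.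
  by rewrite path_t0 -h comp_idr path_t_s.
have [n en] := pcomp_npath h.
by rewrite !path_t_val -en path_t_val (KP2t fam h en).
Qed.

Lemma path_ts l m : deg l = deg m ->
  path_t l ** path_s m = if l == m then p (smap l) else 0.
Proof.
have [[v ->]|[u ->]] := pathP l; have [[w ->]|[x ->]] := pathP m => d.
- rewrite path_s0 path_t0 smap_id (KP1 fam) (inj_eq (f := @idp L)) //.
  exact: can_inj (@rmap_id L).
- by case/eqP: (valP x); rewrite -d deg_id.
- by case/eqP: (valP u); rewrite d deg_id.
- by rewrite path_t_val path_s_val (KP3 fam d) (inj_eq val_inj).
Qed.

Lemma path_tsE l : path_t l ** path_s l = p (smap l).
Proof. by rewrite path_ts // eqxx. Qed.

(** (KP4) as a sum over a duplicate-free list, which row-finiteness makes available, and extended to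
    n = 0, where it reads p_v = p_v p_v. *)
Lemma vertex_expand v n : row_finite L -> exists X : seq (gpath L),
  [/\ uniq X, forall l, (l \in X) <-> paths_from v n l
    & p v = \sum_(l <- X) path_s l ** path_t l].
Proof.
move=> rf; have [->|n0] := eqVneq n 0.
  exists [:: idp v]; split=> //; last first.
    by rewrite big_seq1 path_s0 path_t0 (KP1 fam) eqxx.
  move=> l; rewrite inE; split=> [/eqP ->|[<- d]]; last by rewrite -deg0_id.
  by split; rewrite ?rmap_id ?deg_id.
have fin : finite_set [set l : npath L | paths_from v n (val l)].
  by apply: (finite_preimage _ (rf v n)) => l m _ _; exact: val_inj.
exists (map val (enum_fset (fset_set [set l : npath L | paths_from v n (val l)]))).
split.
- by rewrite map_inj_uniq ?fset_uniq //; exact: val_inj.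
- move=> l; split=> [/mapP[u]|h].
    by move=> hu ->; move: hu; rewrite in_fset_set // inE.
  have nz : deg l != 0 by case: h => _ ->.
  apply/mapP; exists (exist (fun l : gpath L => is_true (deg l != 0)) l nz) => //.
  by rewrite in_fset_set // inE.
- rewrite (KP4 fam v n0) fsbig_finite // big_map.
  by apply: eq_bigr => u _; rewrite path_s_val path_t_val.
Qed.

End Families.

(** * Separation of paths by an aperiodic infinite path *)

Section Conflicts.
Variable L : twoGraph.
Implicit Types a b l u : gpath L.

(** Distinct initial segments of equal degree are the form of disagreement to which (KP3) applies;
    the degrees of a and b themselves may differ. *)
Definition incompat a b : Prop := exists a1 a2 b1 b2,
  [/\ smap a1 = rmap a2 /\ smap b1 = rmap b2, a = pcomp a1 a2, b = pcomp b1 b2,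
      deg a1 = deg b1 & a1 <> b1].

Lemma prepend_pcomp (x : infpath L) a n : smap a = ipv x 0 ->
  pcomp a (ipm x 0 n) = ipm (prepend a x) 0 (deg a + n).
Proof.
move=> ax; have [y0 yp] := prependP ax.
by rewrite -(yp 0 n (le2_0 n)) addr0 -{1}y0 ipm_comp ?le2_0 ?le2_addr.
Qed.

(** By unique factorisation x(p, q) is what remains of x(0, q) after x(0, p), so the initial
    segments determine an infinite path. *)
Lemma infpath_neq (y z : infpath L) : y <> z -> exists q, ipm y 0 q <> ipm z 0 q.
Proof.
move=> yz; apply: contrapT => /forallNP h; apply: yz; apply: tgFunctor_ext => f.
have e q : ipm y 0 q = ipm z 0 q by apply: contrapT; exact: h.
rewrite -(om_val f); set p := (val f).1; set q := (val f).2.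
have pq : le2 p q by exact: (valP f).
have [] // := @factor_uniq _ (ipm y 0 p) (ipm y p q) (ipm z 0 p) (ipm z p q);
  rewrite ?ipm_s ?ipm_r ?le2_0 //; first by rewrite e.
by rewrite !ipm_comp ?le2_0.
Qed.

(** The infinite paths ax and bx already differ on some segment (0, q), and for n >= q both
    truncations have degree at least q, hence contain it. *)
Lemma prepend_incompat (x : infpath L) a b :
  smap a = ipv x 0 -> smap b = ipv x 0 -> prepend a x <> prepend b x ->
  exists M, forall n, le2 M n ->
    incompat (pcomp a (ipm x 0 n)) (pcomp b (ipm x 0 n)).
Proof.
move=> ax bx /infpath_neq[q neq]; exists q => n qn.
have qa m : le2 q (m + n) by apply: le2_trans qn _; exact: le2_addl.
rewrite !prepend_pcomp //.
exists (ipm (prepend a x) 0 q), (ipm (prepend a x) q (deg a + n)).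
exists (ipm (prepend b x) 0 q), (ipm (prepend b x) q (deg b + n)).
split=> //; rewrite ?ipm_comp ?le2_0 ?ipm_s ?ipm_r ?le2_0 //.
by rewrite -[q]add0r !ipm_deg.
Qed.

Lemma aperiodic_separation v a (X : seq (gpath L)) : aperiodic L ->
  smap a = v -> (forall b, b \in X -> smap b = v /\ b <> a) ->
  exists u, rmap u = v /\
    forall b, b \in X -> incompat (pcomp a u) (pcomp b u).
Proof.
move=> /(_ v)[x [xv sep]] av hX.
(* Asking for all n beyond a threshold, not for a single n, lets the thresholds of the members of
   [X] be added up by induction. *)
suff [M hM] : exists M, forall n, le2 M n -> forall b, b \in X ->
    incompat (pcomp a (ipm x 0 n)) (pcomp b (ipm x 0 n)).
  exists (ipm x 0 M); rewrite ipm_r ?le2_0 //; split=> //.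
  exact: hM (le2_refl _).
elim: X hX => [|b X IH] hX; first by exists 0.
have [|M hM] := IH; first by move=> c cX; apply: hX; rewrite inE cX orbT.
have [bv /nesym ab] := hX b (mem_head _ _).
have [N hN] : exists M, forall n, le2 M n ->
    incompat (pcomp a (ipm x 0 n)) (pcomp b (ipm x 0 n)).
  by apply: prepend_incompat; rewrite ?av ?bv //; apply: sep.
exists (M + N) => n h c; rewrite inE => /orP[/eqP ->|cX].
  by apply: hN; apply: le2_trans h; exact: le2_addl.
by apply: hM => //; apply: le2_trans h; exact: le2_addr.
Qed.

End Conflicts.

(** * Linear combinations of the S_b *)

Section PathCombinations.
Variables (K : fieldType) (L : twoGraph) (A : nuAlgType K).
Variables (p : vert L -> A) (s t : npath L -> A).
Hypothesis fam : KP_family p s t.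
Implicit Types l m a b : gpath L.

Let S := path_s p s.
Let T := path_t p t.

(** The product contains T_{a1} S_{b1} in its middle, which vanishes by (KP3). *)
Lemma incompat_ts a b : incompat a b -> T a ** S b = 0.
Proof.
move=> [a1 [a2 [b1 [b2 [[ha hb] -> -> d /eqP/negPf ne]]]]].
rewrite /S /T -(path_t_comp fam) // -(path_s_comp fam) // -!nmulA [X in _ ** X]nmulA.
by rewrite (path_ts fam d) ne nmul0r nmulr0.
Qed.

Lemma path_s_ncomp l m : smap l <> rmap m -> S l ** S m = 0.
Proof.
move=> /eqP/negPf h; rewrite /S -(path_s_s fam l) -(path_s_r fam m).
by rewrite -nmulA [X in _ ** X]nmulA (KP1 fam) h nmul0r nmulr0.
Qed.

(** With u separating a from the other members of [X], the term of a contributes T_{au} S_{au} =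
    p_{s(u)}, and every other term is a product over incompatible paths. *)
Lemma isolate_coef v (X : seq (gpath L)) (f : gpath L -> K) a :
  aperiodic L -> uniq X -> (forall b, b \in X -> smap b = v) -> a \in X ->
  exists u, T (pcomp a u) ** (\sum_(b <- X) f b *: S b) ** S u
            = f a *: p (smap u).
Proof.
move=> ap uX hX aX; have av := hX a aX.
have [|u [uv hu]] := @aperiodic_separation L v a [seq b <- X | b != a] ap av.
  by move=> b; rewrite mem_filter => /andP[/eqP ba /hX].
exists u; rewrite nmul_sumr nmul_suml (bigD1_seq a) //= nmulZr nmulZl.
rewrite -nmulA /S /T (path_s_comp fam) ?av ?uv // (path_tsE fam) smap_comp ?av ?uv //.
rewrite -big_filter big_seq big1 ?addr0 // => b hb.
have bv : smap b = v by apply: hX; move: hb; rewrite mem_filter => /andP[].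
rewrite nmulZr nmulZl -nmulA (path_s_comp fam) ?bv ?uv // incompat_ts ?scaler0 //.
exact: hu.
Qed.

(** [N] bounds the degree lost from l when S_l is multiplied by an algebra element. The bound keeps
    the remaining paths long enough to absorb further ghosts; it is stated additively to avoid
    truncated subtraction. *)
Definition path_comb (l : gpath L) (N : deg2) (z : A) : Prop :=
  exists r : seq (K * gpath L),
    (forall x, x \in r -> smap x.2 = smap l /\ le2 (deg l) (deg x.2 + N)) /\
    z = \sum_(x <- r) x.1 *: S x.2.

Lemma path_comb0 l N : path_comb l N 0.
Proof. by exists [::]; rewrite big_nil. Qed.

Lemma path_combD l N y z :
  path_comb l N y -> path_comb l N z -> path_comb l N (y + z).
Proof.
move=> [r [hr ->]] [q [hq ->]]; exists (r ++ q); rewrite big_cat; split=> // x.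
by rewrite mem_cat => /orP[/hr|/hq].
Qed.

Lemma path_combZ l N c z : path_comb l N z -> path_comb l N (c *: z).
Proof.
move=> [r [hr ->]]; exists [seq (c * x.1, x.2) | x <- r]; split.
  by move=> _ /mapP[x /hr h ->].
by rewrite big_map scaler_sumr; apply: eq_bigr => x _; rewrite scalerA.
Qed.

Lemma path_comb_sum l N (J : eqType) (r : seq J) (F : J -> A) :
  (forall i, i \in r -> path_comb l N (F i)) -> path_comb l N (\sum_(i <- r) F i).
Proof.
by move=> h; rewrite big_seq; elim/big_ind: _ => //;
  [exact: path_comb0|exact: path_combD].
Qed.

Lemma path_comb1 l N m : smap m = smap l -> le2 (deg l) (deg m + N) ->
  path_comb l N (S m).
Proof.
move=> h d; exists [:: (1, m)]; rewrite big_seq1 scale1r; split=> // x.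
by rewrite inE => /eqP ->.
Qed.

(** Successive losses of degree add up. *)
Lemma path_combW l l' N N' z : smap l = smap l' ->
  le2 (deg l') (deg l + N') ->
  path_comb l N z -> path_comb l' (N + N') z.
Proof.
move=> e d [r [hr ->]]; exists r; split=> // x /hr[-> h]; split=> //.
apply: le2_trans d _; rewrite addrA ![_ + N']addrC; exact: le2_add2l.
Qed.

(** Coefficients of repeated paths are collected, since isolating a coefficient requires distinct
    paths. *)
Lemma path_comb_uniq l N z : path_comb l N z ->
  exists (X : seq (gpath L)) (f : gpath L -> K),
    [/\ uniq X, forall b, b \in X -> smap b = smap l
      & z = \sum_(b <- X) f b *: S b].
Proof.
move=> [r [hr ->]].
exists (undup [seq x.2 | x <- r]), (fun b => \sum_(x <- r | x.2 == b) x.1); split.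
- exact: undup_uniq.
- by move=> b; rewrite mem_undup => /mapP[x /hr[h _] ->].
under [RHS]eq_bigr do rewrite scaler_suml.
rewrite (exchange_big_dep predT) //= big_seq [RHS]big_seq.
apply: eq_bigr => x xr; under eq_bigl do rewrite eq_sym.
rewrite -big_filter filter_pred1_uniq ?undup_uniq ?big_seq1 //.
by rewrite mem_undup map_f.
Qed.

End PathCombinations.

(** * Infinite paths as limits of finite ones, and cofinality *)

Section InfinitePathLimit.
Variables (L : twoGraph) (w c : nat -> gpath L).
Hypothesis wS : forall k, w k.+1 = pcomp (w k) (c k).
Hypothesis wc : forall k, smap (w k) = rmap (c k).
Hypothesis deg_w : forall k, deg (w k) = (k, k).

Let w_mono k j p q b : (k <= j)%N -> seg (w k) p q b -> seg (w j) p q b.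
Proof.
move=> /subnKC <-; elim: (j - k)%N => [|i IH]; first by rewrite addn0.
by move=> /IH h; rewrite addnS wS; exact: seg_ext.
Qed.

Let top (q : deg2) := maxn q.1 q.2.

Let le_top q : le2 q (top q, top q).
Proof. by rewrite /le2 leq_maxl leq_maxr. Qed.

Let yex (f : opath) : exists b, seg (w (top (val f).2)) (val f).1 (val f).2 b.
Proof. by apply: seg_exists; [exact: (valP f)|rewrite deg_w le_top]. Qed.

Let ymor f := sval (cid (yex f)).

Let ymorP f k : le2 (val f).2 (k, k) -> seg (w k) (val f).1 (val f).2 (ymor f).
Proof.
move=> /andP[/= h1 h2]; apply: (@w_mono (top (val f).2)).
  by rewrite geq_max h1 h2.
by rewrite /ymor; case: cid.
Qed.

Let yobj p := rmap (ymor (oid p)).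

Let yid p : ymor (oid p) = idp (yobj p).
Proof.
apply: deg0_id; have [a [b [_ _ _ _ e]]] := ymorP (f := oid p) (le_top _).
by apply: (@addd_inj p); rewrite e addr0.
Qed.

Let yr f : rmap (ymor f) = yobj (val f).1.
Proof.
have h : seg (w (top (val f).2)) (val f).1 (val f).1 (ymor (oid (val f).1)).
  by apply: (@ymorP (oid _)); exact: le2_trans (valP f) (le_top _).
have [<- _] := seg_comp h (ymorP (le_top _)).
by rewrite yid smap_id.
Qed.

Let ys f : smap (ymor f) = yobj (val f).2.
Proof.
have h : seg (w (top (val f).2)) (val f).2 (val f).2 (ymor (oid (val f).2)).
  by apply: (@ymorP (oid _)); exact: le_top.
by have [-> _] := seg_comp (ymorP (f := f) (le_top _)) h.
Qed.

Let ycomp (f g : opath) : (val f).2 = (val g).1 ->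
  ymor (ocomp f g) = pcomp (ymor f) (ymor g).
Proof.
move=> e; have fg : le2 (val f).2 (val g).2 by rewrite e; exact: (valP g).
have h : seg (w (top (val g).2)) (val f).1 (val g).2 (ymor (ocomp f g)).
  by have := @ymorP (ocomp f g) (top (val g).2); rewrite val_ocomp //=; apply.
apply: seg_uniq h _.
have /seg_comp := ymorP (le2_trans fg (le_top _)); rewrite e => k.
by have [_] := k _ _ (ymorP (le_top _)).
Qed.

Let ydeg f : deg (ymor f) = odeg f.
Proof.
have [a [b [_ _ _ _ e]]] := ymorP (f := f) (le_top _).
by apply: (@addd_inj (val f).1); rewrite e odegK.
Qed.

(** The degrees (k, k) exceed every element of N^2 eventually, so the segment (p, q) can be read off
    from [w k] for any k with q <= (k, k); uniqueness of segments makes the choice of k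
    immaterial. *)
Lemma infpath_limit : exists x : infpath L, forall k, ipv x (k, k) = smap (w k).
Proof.
exists (@TgFunctor Omega2 L yobj ymor yr ys yid ycomp ydeg) => k /=.
have h : seg (w k) (k, k) (k, k) (idp (smap (w k))).
  exists (w k), (idp (smap (w k))).
  split; rewrite ?smap_id ?rmap_id ?deg_id ?addr0 //.
  by rewrite -{2}[smap (w k)]smap_id comp_idr comp_idr.
have := @ymorP (oid (k, k)) k (le2_refl _); rewrite /ipv /= => h'.
by rewrite -[RHS]rmap_id; congr rmap; exact: seg_uniq h' h.
Qed.

End InfinitePathLimit.

(* Only the vertices x(k, k) of an infinite path matter for cofinality, and
   these can be chosen one after the other. *)
Lemma cofinal_saturated (L : twoGraph) (H : set (vert L)) (w : vert L) :
  cofinal L -> H w ->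
  (forall l : gpath L, H (rmap l) -> H (smap l)) ->
  (forall v, (forall l, paths_from v (1, 1)%N l -> H (smap l)) -> H v) ->
  H = setT.
Proof.
move=> cof Hw her sat; apply/seteqP; split=> // v0 _.
apply: contrapT => nHv0.
have step v : ~ H v -> exists l, paths_from v (1, 1)%N l /\ ~ H (smap l).
  move=> nH; apply: contrapT => /forallNP h; apply: nH; apply: sat => l hl.
  by apply: contrapT => nl; apply: (h l).
(* On vertices in [H] the value [idp v] is only a default; the sequence [pre] never reaches such a
   vertex. *)
have /choice[nxt nxtP] : forall v, exists l, ~ H v ->
    paths_from v (1, 1)%N l /\ ~ H (smap l).
  move=> v; have [hv|/step[l hl]] := pselect (H v); first by exists (idp v).
  by exists l.
pose pre := fix pre k := if k is j.+1 then pcomp (pre j) (nxt (smap (pre j)))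
            else idp v0.
have preP k : ~ H (smap (pre k)) /\ deg (pre k) = (k, k).
  elim: k => [|k [nH d]] /=; first by rewrite smap_id deg_id.
  have [[r1 d1] nH1] := nxtP _ nH.
  rewrite smap_comp ?r1 // deg_comp ?r1 // d d1; split=> //.
  by apply: deg2E; exact: addn1.
have [|||x xP] := @infpath_limit L pre (fun k => nxt (smap (pre k))) => //.
- by move=> k; have [[-> _] _] := nxtP _ (preP k).1.
- by move=> k; exact: (preP k).2.
(* A path from w to x(n), continued along x to x(m, m) with m the larger coordinate of n, carries
   membership in [H] to a vertex chosen outside [H]. *)
have [n [l [rl sl]]] := cof x w.
have nle : le2 n (maxn n.1 n.2, maxn n.1 n.2) by rewrite /le2 leq_maxl leq_maxr.
apply: (preP (maxn n.1 n.2)).1; rewrite -xP -(ipm_s x nle).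
by apply: (her); rewrite ipm_r // -sl; apply: her; rewrite rl.
Qed.

(** * Ideals of the Kumjian-Pask algebra and simplicity *)

Section KPIdeals.
Variables (K : fieldType) (L : twoGraph).
Hypothesis rf : row_finite L.

Let fam := KP_is_family K rf.
Let S := path_s (@kp_v K L) (@kp_s K L).
Let T := path_t (@kp_v K L) (@kp_t K L).

(** Every element is the class of a term, and opposites are multiples by -1. *)
Lemma KP_ind (P : KP K L -> Prop) :
  (forall l, P (S l)) -> (forall l, P (T l)) -> P 0 ->
  (forall a b, P a -> P b -> P (a + b)) ->
  (forall c a, P a -> P (c *: a)) ->
  (forall a b, P a -> P b -> P (a ** b)) -> forall a, P a.
Proof.
move=> Ps Pt P0 PD PZ PM a; rewrite -(kpi_repr a).
elim: (repr a) => [v|l|l||u IH|u IHu w IHw|c u IH|u IHu w IHw].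
- by have := Ps (idp v); rewrite /S path_s0.
- by have := Ps (val l); rewrite /S path_s_val.
- by have := Pt (val l); rewrite /T path_t_val.
- exact: P0.
- suff -> : kpi (KP_opp u) = -1 *: kpi u by exact: PZ.
  by apply/kpi_eqP => A p s t f /=; rewrite (kpiK _ f) scaleN1r.
- suff -> : kpi (KP_add u w) = kpi u + kpi w by exact: PD.
  by apply/kpi_eqP => A p s t f /=; rewrite !(kpiK _ f).
- suff -> : kpi (KP_scale c u) = c *: kpi u by exact: PZ.
  by apply/kpi_eqP => A p s t f /=; rewrite !(kpiK _ f).
- suff -> : kpi (KP_mul u w) = kpi u ** kpi w by exact: PM.
  by apply/kpi_eqP => A p s t f /=; rewrite !(kpiK _ f).
Qed.

(** A generator is fixed on the right by a single vertex, and orthogonality kills all others.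
    Allowing every larger [G] lets the supports of two summands be merged. *)
Lemma KP_local_unit (a : KP K L) : exists F : seq (vert L),
  forall G, uniq G -> {subset F <= G} -> a ** (\sum_(v <- G) kp_v K v) = a.
Proof.
have unit1 b u : b ** kp_v K u = b -> exists F : seq (vert L),
  forall G, uniq G -> {subset F <= G} -> b ** (\sum_(v <- G) kp_v K v) = b.
  move=> bu; exists [:: u] => G uG /(_ u (mem_head _ _)) uG'.
  rewrite nmul_sumr (bigD1_seq u) //= bu big1 ?addr0 // => v vu.
  by rewrite -bu -nmulA (KP1 fam) eq_sym (negPf vu) nmulr0.
elim/KP_ind: a => [l|l||a b [F hF] [G hG]|c a [F hF]|a b _ [F hF]].
- by apply: unit1; exact: (path_s_s fam).
- by apply: unit1; exact: (path_t_r fam).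
- by exists [::] => G _ _; rewrite nmul0r.
- exists (F ++ G) => H uH sub; rewrite nmulDl hF ?hG // => v vF; apply: sub;
    by rewrite mem_cat vF ?orbT.
- by exists F => G uG sub; rewrite nmulZl hF.
- by exists F => G uG sub; rewrite -nmulA hF.
Qed.

(** Multiplying by a long S_l removes all ghosts from a. *)
Lemma KP_path_comb (a : KP K L) : exists N : deg2, forall l, le2 N (deg l) ->
  path_comb (@kp_v K L) (@kp_s K L) l N (a ** S l).
Proof.
elim/KP_ind: a => [m|m||a b [N hN] [M hM]|c a [N hN]|a b [N hN] [M hM]].
- exists 0 => l _; have [h|h] := eqVneq (smap m) (rmap l).
    rewrite /S (path_s_comp fam) //; apply: path_comb1; rewrite ?smap_comp //.
    by rewrite deg_comp // addr0 le2_addl.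
  by rewrite /S (path_s_ncomp fam) //; [exact: path_comb0|exact/eqP].
(* For a ghost T_m, split l = l1 l2 with d(l1) = d(m): (KP3) leaves S_{l2} if l1 = m and 0
   otherwise. *)
- exists (deg m) => l /le2_split[n d].
  have [[l1 l2] [[/= d1 d2 h ->] _]] := factorisation d.
  rewrite /S /T -(path_s_comp fam) // nmulA (path_ts fam) //.
  case: eqP => [->|_]; last by rewrite nmul0r; exact: path_comb0.
  rewrite h (path_s_r fam); apply: path_comb1; rewrite ?smap_comp //.
  by rewrite deg_comp // d1 addrC le2_refl.
- by exists 0 => l _; rewrite nmul0r; exact: path_comb0.
- exists (N + M) => l h; rewrite nmulDl; apply: path_combD.
    apply: path_combW (hN l _); rewrite ?le2_addr //.
    exact: le2_trans (le2_addr _ _) h.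
  rewrite [N + M]addrC.
  apply: path_combW (hM l _); rewrite ?le2_addr //.
  exact: le2_trans (le2_addl _ _) h.
- by exists N => l h; rewrite nmulZl; apply: path_combZ; exact: hN.
- exists (N + M) => l h; rewrite -nmulA.
  have [r [hr ->]] := hM l (le2_trans (le2_addl _ _) h).
  rewrite nmul_sumr; apply: path_comb_sum => x /hr[e d].
  rewrite nmulZr; apply: path_combZ; apply: (@path_combW _ _ _ _ _ x.2) => //.
  (* Each path x in b S_l satisfies N + M <= d(l) <= d(x) + M, so it is still long enough for a. *)
  apply: hN; have := le2_trans h d; rewrite /le2 /= !leq_add2r //.
Qed.

(** If a S_l vanished for all long l, then (KP4) would give a p_v = 0 for every v, and a = 0 by the
    local units. *)
Lemma KP_nonzero_comb (a : KP K L) : a <> 0 ->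
  exists l (X : seq (gpath L)) (f : gpath L -> K),
    [/\ uniq X, forall b, b \in X -> smap b = smap l,
        a ** S l = \sum_(b <- X) f b *: S b & a ** S l <> 0].
Proof.
move=> a0; have [F hF] := KP_local_unit a.
have [N hN] := KP_path_comb a.
have [l [lN al]] : exists l, le2 N (deg l) /\ a ** S l <> 0.
  apply: contrapT => /forallNP h; apply: a0.
  have as0 l : le2 N (deg l) -> a ** S l = 0.
    by move=> d; apply: contrapT => n; apply: (h l).
  rewrite -(hF (undup F)) ?undup_uniq //; last by move=> v; rewrite mem_undup.
  rewrite nmul_sumr big1 // => v _.
  have [X [_ hX ->]] := vertex_expand fam v N rf.
  rewrite nmul_sumr big_seq big1 // => l /hX[_ d].
  by rewrite nmulA as0 ?nmul0r // d le2_refl.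
have [X [f [uX sX e]]] := path_comb_uniq (hN l lN).
by exists l, X, f.
Qed.

Lemma KP_ideal_vertex (I : set (KP K L)) a : aperiodic L ->
  two_sided_ideal I -> I a -> a <> 0 -> exists w, I (kp_v K w).
Proof.
move=> ap hI Ia /KP_nonzero_comb[l [X [f [uX sX e n0]]]].
have [b bX fb] : exists2 b, b \in X & f b != 0.
  apply: contrapT => h; apply: n0; rewrite e big_seq big1 // => b bX.
  have [->|fb] := eqVneq (f b) 0; first by rewrite scale0r.
  by case: h; exists b.
have [u hu] := isolate_coef fam f ap uX sX bX.
exists (smap u).
have -> : kp_v K (smap u) = (f b)^-1 *: (f b *: kp_v K (smap u)).
  by rewrite scalerA mulVf // scale1r.
rewrite -hu -e -!nmulZl; apply: idealMr => //; apply: idealMl => //.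
exact: idealMr.
Qed.

(** The set of vertices in I is hereditary because p_{s(l)} = T_l p_{r(l)} S_l, and saturated
    because p_u is the sum of the S_l p_{s(l)} T_l. *)
Lemma KP_ideal_all_vertices (I : set (KP K L)) w : cofinal L ->
  two_sided_ideal I -> I (kp_v K w) -> forall v, I (kp_v K v).
Proof.
move=> cof hI Iw v.
have /seteqP[_ h] : [set v | I (kp_v K v)] = setT; last exact: (h v Logic.I).
apply: (cofinal_saturated cof Iw) => [l Il|u hu] /=.
  rewrite -(path_tsE fam) -(path_s_r fam l).
  by apply: idealMl => //; exact: idealMr.
have [X [_ hX ->]] := vertex_expand fam u (1, 1)%N rf.
apply: ideal_sum => // l /hX lX; rewrite -(path_s_s fam).
by apply: idealMr => //; apply: idealMl => //; exact: hu.
Qed.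

Lemma KP_ideal_trivial (I : set (KP K L)) : aperiodic L -> cofinal L ->
  two_sided_ideal I -> I = [set 0] \/ I = setT.
Proof.
move=> ap cof hI.
have [[a [Ia a0]]|h] := pselect (exists a, I a /\ a <> 0); last first.
  left; apply/seteqP; split=> a /= => [Ia|->]; last exact: ideal0.
  by apply: contrapT => a0; apply: h; exists a.
right; apply/seteqP; split=> // b _.
have [w Iw] := KP_ideal_vertex ap hI Ia a0.
have [F hF] := KP_local_unit b.
rewrite -(hF (undup F)) ?undup_uniq //; last by move=> v; rewrite mem_undup.
apply: idealMl => //; apply: ideal_sum => // v _.
exact: KP_ideal_all_vertices Iw v.
Qed.

End KPIdeals.

(** * Sequences of matrices modulo eventual equality *)

Section MatrixGerms.
Variables (K : fieldType) (d : nat -> nat).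
Implicit Types f g : forall N, 'M[K]_(d N).

Definition eventual (P : nat -> Prop) : Prop :=
  exists M, forall N, (M <= N)%N -> P N.

Lemma eventuallyI2 (P Q R : nat -> Prop) :
  (forall N, P N -> Q N -> R N) ->
  eventual P -> eventual Q -> eventual R.
Proof.
move=> h [M hM] [M' hM']; exists (maxn M M') => N; rewrite geq_max => /andP[a b].
by apply: h; [exact: hM|exact: hM'].
Qed.

Definition mxseq := forall N, 'M[K]_(d N).
HB.instance Definition _ := gen_eqMixin mxseq.
HB.instance Definition _ := gen_choiceMixin mxseq.

Definition mxeq (f g : mxseq) : bool := `[< eventual (fun N => f N = g N) >].

Lemma mxeq_refl : reflexive mxeq.
Proof. by move=> f; apply/asboolP; exists 0%N. Qed.

Lemma mxeq_sym : symmetric mxeq.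
Proof.
by move=> f g; apply/asboolP/asboolP => -[M hM]; exists M => N /hM ->.
Qed.

Lemma mxeq_trans : transitive mxeq.
Proof.
move=> g f h /asboolP hf /asboolP hg; apply/asboolP.
by apply: eventuallyI2 hf hg => N -> ->.
Qed.

Canonical mxeq_equiv := EquivRel mxeq mxeq_refl mxeq_sym mxeq_trans.

(** The product of the M_{d N}(K) modulo their direct sum. *)
Definition mxgerm := {eq_quot mxeq_equiv}%qT.
HB.instance Definition _ := Choice.on mxgerm.
HB.instance Definition _ := EqQuotient.on mxgerm.

Definition germ (f : mxseq) : mxgerm := (\pi_mxgerm f)%qT.

Lemma germ_eqP f g : germ f = germ g <-> eventual (fun N => f N = g N).
Proof.
split => [/eqP|h]; first by rewrite /germ piE => /asboolP.
by apply/eqP; rewrite /germ piE; apply/asboolP.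
Qed.

Lemma germ_repr (a : mxgerm) : germ (repr a) = a.
Proof. exact: reprK. Qed.

Lemma repr_germ f : eventual (fun N => repr (germ f) N = f N).
Proof. by apply/germ_eqP; rewrite germ_repr. Qed.

Lemma germ_ext f g : (forall N, f N = g N) -> germ f = germ g.
Proof. by move=> h; apply/germ_eqP; exists 0%N. Qed.

Definition germ_add (a b : mxgerm) : mxgerm := germ (fun N => repr a N + repr b N).
Definition germ_opp (a : mxgerm) : mxgerm := germ (fun N => - repr a N).
Definition germ_scale (c : K) (a : mxgerm) : mxgerm := germ (fun N => c *: repr a N).
Definition germ_mul (a b : mxgerm) : mxgerm := germ (fun N => repr a N *m repr b N).

Lemma germ_addE f g : germ_add (germ f) (germ g) = germ (fun N => f N + g N).
Proof.
apply/germ_eqP; apply: eventuallyI2 (repr_germ f) (repr_germ g) => N.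
by move=> -> ->.
Qed.

Lemma germ_mulE f g : germ_mul (germ f) (germ g) = germ (fun N => f N *m g N).
Proof.
apply/germ_eqP; apply: eventuallyI2 (repr_germ f) (repr_germ g) => N.
by move=> -> ->.
Qed.

Lemma germ_scaleE c f : germ_scale c (germ f) = germ (fun N => c *: f N).
Proof. by apply/germ_eqP; have [M hM] := repr_germ f; exists M => N /hM ->. Qed.

Lemma germ_oppE f : germ_opp (germ f) = germ (fun N => - f N).
Proof. by apply/germ_eqP; have [M hM] := repr_germ f; exists M => N /hM ->. Qed.

Let germW (P : mxgerm -> Prop) : (forall f, P (germ f)) -> forall a, P a.
Proof. by move=> h a; rewrite -(germ_repr a). Qed.

Lemma germ_addA : associative germ_add.
Proof.
elim/germW => f; elim/germW => g; elim/germW => h.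
by rewrite !germ_addE; apply: germ_ext => N; rewrite addrA.
Qed.

Lemma germ_addC : commutative germ_add.
Proof.
elim/germW => f; elim/germW => g.
by rewrite !germ_addE; apply: germ_ext => N; rewrite addrC.
Qed.

Lemma germ_add0 : left_id (germ (fun=> 0)) germ_add.
Proof.
by elim/germW => f; rewrite germ_addE; apply: germ_ext => N; rewrite add0r.
Qed.

Lemma germ_addN : left_inverse (germ (fun=> 0)) germ_opp germ_add.
Proof.
elim/germW => f; rewrite germ_oppE germ_addE.
by apply: germ_ext => N; rewrite addNr.
Qed.

HB.instance Definition _ :=
  GRing.isZmodule.Build mxgerm germ_addA germ_addC germ_add0 germ_addN.

Lemma germD f g : germ f + germ g = germ (fun N => f N + g N).
Proof. exact: germ_addE. Qed.

Lemma germ_scaleA c e a : germ_scale c (germ_scale e a) = germ_scale (c * e) a.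
Proof.
elim/germW: a => f; rewrite !germ_scaleE.
by apply: germ_ext => N; rewrite scalerA.
Qed.

Lemma germ_scale1 : left_id 1 germ_scale.
Proof.
by elim/germW => f; rewrite germ_scaleE; apply: germ_ext => N; rewrite scale1r.
Qed.

Lemma germ_scaleDr : right_distributive germ_scale +%R.
Proof.
move=> c; elim/germW => f; elim/germW => g.
by rewrite germD !germ_scaleE germD; apply: germ_ext => N; rewrite scalerDr.
Qed.

Lemma germ_scaleDl a : {morph germ_scale^~ a : c e / c + e}.
Proof.
elim/germW: a => f c e.
by rewrite !germ_scaleE germD; apply: germ_ext => N; rewrite scalerDl.
Qed.

HB.instance Definition _ := GRing.Zmodule_isLmodule.Build K mxgerm
  germ_scaleA germ_scale1 germ_scaleDr germ_scaleDl.

Lemma germZ c f : c *: germ f = germ (fun N => c *: f N).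
Proof. exact: germ_scaleE. Qed.

Lemma germ_mulA : associative germ_mul.
Proof.
elim/germW => f; elim/germW => g; elim/germW => h.
by rewrite !germ_mulE; apply: germ_ext => N; rewrite mulmxA.
Qed.

Lemma germ_mulDl : left_distributive germ_mul +%R.
Proof.
elim/germW => f; elim/germW => g; elim/germW => h.
by rewrite !(germD, germ_mulE); apply: germ_ext => N; rewrite mulmxDl.
Qed.

Lemma germ_mulDr : right_distributive germ_mul +%R.
Proof.
elim/germW => f; elim/germW => g; elim/germW => h.
by rewrite !(germD, germ_mulE); apply: germ_ext => N; rewrite mulmxDr.
Qed.

Lemma germ_mulZl (c : K) (a b : mxgerm) : germ_mul (c *: a) b = c *: germ_mul a b.
Proof.
elim/germW: a => f; elim/germW: b => g.
by rewrite germZ !germ_mulE germZ; apply: germ_ext => N; rewrite -scalemxAl.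
Qed.

Lemma germ_mulZr (c : K) (a b : mxgerm) : germ_mul a (c *: b) = c *: germ_mul a b.
Proof.
elim/germW: a => f; elim/germW: b => g.
by rewrite germZ !germ_mulE germZ; apply: germ_ext => N; rewrite -scalemxAr.
Qed.

HB.instance Definition _ := Lmodule_isNuAlgebra.Build K mxgerm
  germ_mulA germ_mulDl germ_mulDr germ_mulZl germ_mulZr.

Lemma germM f g : germ f ** germ g = germ (fun N => f N *m g N).
Proof. exact: germ_mulE. Qed.

Lemma germ0 : 0 = germ (fun=> 0). Proof. by []. Qed.

Lemma germ_sum (J : Type) (r : seq J) (F : J -> mxseq) :
  \sum_(j <- r) germ (F j) = germ (fun N => \sum_(j <- r) F j N).
Proof.
elim: r => [|j r IH].
  by rewrite big_nil germ0; apply: germ_ext => N; rewrite big_nil.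
rewrite big_cons IH germD; apply: germ_ext => N; by rewrite big_cons.
Qed.

(* The rank makes the algebra of germs directly finite. *)
Lemma mxgerm_no_infinite_idempotent (p : mxgerm) : ~ infinite_idempotent p.
Proof.
move=> [pp [p1 [p2 [x [y [[i1 _ i2 n2] [o12 o21] _ [ps pxy p1yx]]]]]]].
apply: n2; move: i1 i2 o12 o21 ps pxy p1yx pp; rewrite /idempotent_elt.
rewrite -(germ_repr p) -(germ_repr p1) -(germ_repr p2) -(germ_repr x) -(germ_repr y).
move: (repr p) (repr p1) (repr p2) (repr x) (repr y).
move=> {}p {}p1 {}p2 {}x {}y; rewrite !germM germD germ0 !germ_eqP.
move=> [M1 h1] [M2 h2] [M3 h3] [M4 h4] [M5 h5] [M6 h6] [M7 h7] [M8 h8].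
exists (M1 + M2 + M3 + M4 + M5 + M6 + M7 + M8)%N => N hN.
have {}h1 := h1 N; have {}h2 := h2 N; have {}h3 := h3 N; have {}h4 := h4 N.
have {}h5 := h5 N; have {}h6 := h6 N; have {}h7 := h7 N; have {}h8 := h8 N.
rewrite -!addnA in hN.
have {}h1 : p1 N *m p1 N = p1 N by apply: h1; lia.
have {}h2 : p2 N *m p2 N = p2 N by apply: h2; lia.
have {}h3 : p1 N *m p2 N = 0 by apply: h3; lia.
have {}h4 : p2 N *m p1 N = 0 by apply: h4; lia.
have {}h5 : p N = p1 N + p2 N by apply: h5; lia.
have {}h6 : p N = x N *m y N by apply: h6; lia.
have {}h7 : p1 N = y N *m x N by apply: h7; lia.
have {}h8 : p N *m p N = p N by apply: h8; lia.
(* Since p = pp = x(yx)y factors through p1, and p1 = p1 p, the row spaces of p and p1 coincide.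
   That of p2 lies in it, so p2 = D p1 and p2 = p2 p2 = D p1 p2 = 0. *)
have rk : (\rank (p N) <= \rank (p1 N))%N.
  have -> : p N = x N *m (p1 N *m y N) by rewrite -[LHS]h8 h6 h7 !mulmxA.
  by apply: leq_trans (mxrankM_maxr _ _) _; exact: mxrankM_maxl.
have p1p : (p1 N <= p N)%MS.
  have -> : p1 N = p1 N *m p N by rewrite h5 mulmxDr h1 h3 addr0.
  exact: submxMl.
have pp1 : (p N <= p1 N)%MS.
  by have [_ <-] := mxrank_leqif_sup p1p; rewrite eqn_leq rk mxrankS.
have p2p : p2 N *m p N = p2 N by rewrite h5 mulmxDr h2 h4 add0r.
have /submxP[D e] : (p2 N <= p1 N)%MS.
  by rewrite -p2p; apply: submx_trans (submxMl _ _) pp1.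
by rewrite -h2 {1}e -mulmxA h3 mulmx0.
Qed.

End MatrixGerms.

(** * 0-1 matrices of relations *)

Section RelationMatrices.
Variables (K : fieldType) (X : finType).
Implicit Types R : X -> X -> Prop.

Definition relmx R : 'M[K]_#|X| :=
  \matrix_(i, j) (`[< R (enum_val i) (enum_val j) >])%:R.

Lemma relmx_ext R R' : (forall a b, R a b <-> R' a b) -> relmx R = relmx R'.
Proof.
move=> h; apply/matrixP => i j; rewrite !mxE.
by congr (nat_of_bool _)%:R; apply/asbool_equiv_eq/h.
Qed.

Lemma relmx_tr R : (relmx R)^T = relmx (fun a b => R b a).
Proof. by apply/matrixP => i j; rewrite !mxE. Qed.

Lemma relmx0 R : (forall a b, ~ R a b) -> relmx R = 0.
Proof. by move=> h; apply/matrixP => i j; rewrite !mxE asboolF. Qed.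

(** Uniqueness of the intermediate point makes each entry of the product a sum with at most one term
    1, so the count is correct in every characteristic. *)
Lemma relmx_mul R1 R2 :
  (forall a b b' c, R1 a b -> R2 b c -> R1 a b' -> R2 b' c -> b = b') ->
  relmx R1 *m relmx R2 = relmx (fun a c => exists b, R1 a b /\ R2 b c).
Proof.
move=> u; apply/matrixP => i j; rewrite !mxE.
under eq_bigr do rewrite !mxE -natrM mulnb -asbool_and.
case: (pselect (exists b, R1 (enum_val i) b /\ R2 b (enum_val j))) => [h|h].
  rewrite (asboolT h); have [b [h1 h2]] := h.
  rewrite (bigD1 (enum_rank b)) //= enum_rankK asboolT // big1 ?addr0 // => k kb.
  rewrite asboolF // => -[k1 k2]; case/eqP: kb; rewrite -[k]enum_valK.
  by congr enum_rank; exact: u k1 k2 h1 h2.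
rewrite (asboolF h) big1 // => k _; rewrite asboolF // => hk.
by apply: h; exists (enum_val k).
Qed.

(** Disjointness of the relations again keeps the entries at 0 or 1. *)
Lemma relmx_sum (J : eqType) (r : seq J) (R : J -> X -> X -> Prop) : uniq r ->
  (forall j j' a b, R j a b -> R j' a b -> j = j') ->
  \sum_(j <- r) relmx (R j) = relmx (fun a b => exists2 j, j \in r & R j a b).
Proof.
move=> ur u; apply/matrixP => i j; rewrite summxE !mxE.
under eq_bigr do rewrite !mxE.
case: (pselect (exists2 k, k \in r & R k (enum_val i) (enum_val j))) => [h|h].
  rewrite (asboolT h); have [k kr hk] := h.
  rewrite (bigD1_seq k) //= asboolT // big1 ?addr0 // => l /eqP lk.
  by rewrite asboolF // => hl; apply: lk; exact: u hl hk.
rewrite (asboolF h) big_seq big1 // => k kr; rewrite asboolF // => hk.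
by apply: h; exists k.
Qed.

Lemma relmx_neq0 R a b : R a b -> relmx R <> 0.
Proof.
move=> h /matrixP/(_ (enum_rank a) (enum_rank b)).
rewrite !mxE !enum_rankK asboolT // => /eqP; by rewrite oner_eq0.
Qed.

End RelationMatrices.

(** * The action of paths on blue paths *)

(* In a rank-2 Bratteli diagram each path l a, with a blue, is b r for a unique
   blue b and red r; the path l acts on blue paths by a |-> b. *)
Section BlueAction.
Variable L : twoGraph.
Implicit Types a b c l m r : gpath L.

Definition blue a : Prop := (deg a).2 = 0%N.

Definition blue_act l b a : Prop :=
  smap l = rmap a /\ exists r, [/\ smap b = rmap r, (deg r).1 = 0%N
                                 & pcomp l a = pcomp b r].

Hypothesis red1 : forall v : vert L, exists! f : gpath L, deg f = e2 /\ rmap f = v.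

(** Each vertex is the range of a single red edge, so the edges of a red path are forced one after
    the other from its range. *)
Lemma red_path_unique r r' : deg r = deg r' -> (deg r).1 = 0%N ->
  rmap r = rmap r' -> r = r'.
Proof.
move=> d h; have [k dk] : exists k, deg r = (0%N, k).
  by exists (deg r).2; rewrite -h -surjective_pairing.
move: d; rewrite dk => /esym d'; clear h.
elim: k r r' dk d' => [|k IH] r r' d d' e.
  by rewrite (deg0_id d) e -deg0_id.
have [[f g] [[/= df dg h Er] _]] := @factorisation L r e2 (0%N, k) d.
have [[f' g'] [[/= df' dg' h' E] _]] := @factorisation L r' e2 (0%N, k) d'.
have ff : f = f'.
  have [x [_ ux]] := red1 (rmap r).
  rewrite -(ux f); first by apply: ux; split=> //; rewrite e E rmap_comp.
  by split=> //; rewrite Er rmap_comp.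
by rewrite Er E; move: h'; rewrite -ff => h'; congr pcomp; apply: IH => //; rewrite -h.
Qed.

Lemma blue_red_deg b r : smap b = rmap r -> blue b -> (deg r).1 = 0%N ->
  deg b = ((deg (pcomp b r)).1, 0%N) /\ deg r = (0%N, (deg (pcomp b r)).2).
Proof.
move=> h; rewrite /blue deg_comp //; case: (deg b) (deg r) => [b1 b2] [r1 r2] /=.
by move=> -> ->; split; apply: deg2E => //=; exact: esym (addn0 _).
Qed.

Lemma blue_act_ex l a : smap l = rmap a -> exists b, blue b /\ blue_act l b a.
Proof.
move=> h; have d : deg (pcomp l a) =
    ((deg (pcomp l a)).1, 0%N) + (0%N, (deg (pcomp l a)).2).
  by apply: deg2E => //=; exact: esym (addn0 _).
have [[b r] [[/= db dr k e] _]] := factorisation d.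
by exists b; rewrite /blue db; do 2!split=> //; exists r; split; rewrite ?dr.
Qed.

(** The two red remainders have the same range s(b) and the same degree, hence coincide, and la = mc
    factors uniquely. For l = m this is injectivity of the action; for l and m distinct of equal
    degree it says that their images are disjoint, as (KP3) demands. *)
Lemma blue_act_same l m a b c : blue a -> blue b -> blue c -> deg l = deg m ->
  blue_act l b a -> blue_act m b c -> l = m /\ a = c.
Proof.
move=> ha hb hc d [la [r [br r0 e]]] [mc [r' [br' r0' e']]].
have [_ dr] := blue_red_deg br hb r0; have [_ dr'] := blue_red_deg br' hb r0'.
have rr : r = r'.
  apply: red_path_unique => //; last by rewrite -br.
  rewrite dr dr' -e -e' !deg_comp // d; move: ha hc; rewrite /blue.
  by case: (deg a) (deg c) => [? ?] [? ?] /= -> ->.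
by apply: factor_uniq => //; rewrite e e' rr.
Qed.

Lemma blue_act_fun l a b b' : blue b -> blue b' ->
  blue_act l b a -> blue_act l b' a -> b = b'.
Proof.
move=> hb hb' [_ [r [br r0 e]]] [_ [r' [br' r0' e']]].
have [db _] := blue_red_deg br hb r0; have [db' _] := blue_red_deg br' hb' r0'.
have [] // := @factor_uniq _ b r b' r' => //; last by rewrite -e -e'.
by rewrite db db' -e -e'.
Qed.

Lemma blue_act_comp l m a c : smap l = rmap m -> blue a -> blue c ->
  blue_act (pcomp l m) a c <-> exists b, [/\ blue b, blue_act l a b & blue_act m b c].
Proof.
move=> lm ha hc.
have fwd b a' : blue b -> blue_act m b c -> blue_act l a' b ->
    blue_act (pcomp l m) a' c.
  move=> hb [mc [r [br r0 e]]] [lb [r' [ar r0' e']]]; split; first by rewrite smap_comp.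
  have rr : smap r' = rmap r by rewrite -br -(smap_comp lb) e' smap_comp.
  exists (pcomp r' r); split; rewrite ?rmap_comp //.
    by rewrite deg_comp //= r0 r0'.
  by rewrite -pcompA // e !pcompA // e'.
split=> [h|[b [hb h1 h2]]]; last exact: (fwd b).
have mc : smap m = rmap c by case: h; rewrite smap_comp.
(* Acting by m and then by l yields one result of the action of lm; as that action is single-valued,
   the result is a. *)
have [b [hb mb]] := blue_act_ex mc; exists b; split=> //.
have lb : smap l = rmap b.
  by have [_ [r [br _ e]]] := mb; rewrite lm -(rmap_comp mc) e rmap_comp.
have [a' [ha' la']] := blue_act_ex lb.
by rewrite (blue_act_fun ha ha' h (fwd b a' hb mb la')).
Qed.

Lemma blue_act_id v a b : blue a -> blue b ->
  blue_act (idp v) a b <-> a = b /\ rmap b = v.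
Proof.
move=> ha hb.
have idb : rmap b = v -> blue_act (idp v) b b.
  move=> rb; split; first by rewrite smap_id.
  exists (idp (smap b)); rewrite rmap_id deg_id; split=> //.
  by rewrite -rb comp_idl comp_idr.
split=> [h|[-> rb]]; last exact: idb.
have rb : rmap b = v by case: h; rewrite smap_id.
by split=> //; exact: blue_act_fun ha hb h (idb rb).
Qed.

Lemma blue_act_rmap l a b : blue_act l b a -> rmap b = rmap l.
Proof. by move=> [h [r [br _ e]]]; rewrite -(rmap_comp h) e rmap_comp. Qed.

(** Appending a red path of length n.2 at s(a) makes the degree at least n, so a prefix l of degree
    n splits off and leaves a blue path b. This is the source of (KP4). *)
Lemma blue_act_expand n a : no_sources L -> blue a -> (n.1 <= (deg a).1)%N ->
  exists l b, [/\ paths_from (rmap a) n l, blue b & blue_act l a b].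
Proof.
move=> /(_ (smap a) (0%N, n.2))[r [rr dr]] ha na.
have d : deg (pcomp a r) = n + ((deg a).1 - n.1, 0)%N.
  rewrite deg_comp // dr; move: ha na; rewrite /blue.
  case: n (deg a) {dr} => [n1 n2] [a1 a2] /= -> h.
  apply: deg2E => /=; last by rewrite -[LHS]/(0 + n2)%N -[RHS]/(n2 + 0)%N addn0.
  by rewrite -[LHS]/(a1 + 0)%N -[RHS]/(n1 + (a1 - n1))%N addn0 subnKC.
have [[l b] [[/= dl db h e] _]] := factorisation d.
exists l, b; split; rewrite /blue ?db //.
  by split=> //; rewrite -(rmap_comp h) -e rmap_comp.
by split=> //; exists r; rewrite dr rr e.
Qed.

Variable lev : vert L -> nat.
Hypothesis lev_blue : forall e : gpath L, deg e = e1 -> lev (smap e) = (lev (rmap e)).+1.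
Hypothesis lev_red : forall f : gpath L, deg f = e2 -> lev (smap f) = lev (rmap f).

Lemma lev_path l : lev (smap l) = (lev (rmap l) + (deg l).1)%N.
Proof.
have [n] := ubnP ((deg l).1 + (deg l).2)%N; elim: n l => // n IH l.
case d : (deg l) => [[|i] [|j]] /= hn.
- by rewrite (deg0_id d) smap_id rmap_id addn0.
- have [[f g] [[/= df dg h e] _]] := @factorisation L l e2 (0%N, j) d.
  rewrite e smap_comp // rmap_comp // IH ?dg -?h ?(lev_red df) //=; lia.
- have [[f g] [[/= df dg h e] _]] := @factorisation L l e1 (i, 0%N) d.
  rewrite e smap_comp // rmap_comp // IH ?dg -?h ?(lev_blue df) //=; lia.
- have [[f g] [[/= df dg h e] _]] := @factorisation L l e1 (i, j.+1) d.
  rewrite e smap_comp // rmap_comp // IH ?dg -?h ?(lev_blue df) //=; lia.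
Qed.

(** The red path joining the two sources stays in one level, so the action preserves each P_N. *)
Lemma blue_act_lev l a b : blue_act l b a -> lev (smap b) = lev (smap a).
Proof.
move=> [h [r [br r0 e]]].
by rewrite -(smap_comp h) e smap_comp // (lev_path r) r0 addn0 br.
Qed.

(** A blue path of length k with source in V_N has its range in V_{N-k}; there are finitely many k,
    finitely many ranges, and finitely many paths for each. *)
Lemma finite_blue_paths N : row_finite L ->
  (forall n, finite_set [set v | lev v = n]) ->
  finite_set [set a | blue a /\ lev (smap a) = N].
Proof.
move=> rf fV.
have fin : finite_set (\bigcup_(k in `I_N.+1) \bigcup_(v in [set v | lev v = (N - k)%N])
    paths_from v (k, 0%N)).
  apply: bigcup_finite => [|k _]; first exact: finite_II.
  by apply: bigcup_finite => [|v _]; [exact: fV|exact: rf].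
apply: sub_finite_set fin => a [ha <-]; have la := lev_path a.
exists (deg a).1; first by rewrite /= ltnS la leq_addl.
exists (rmap a); first by rewrite /= la addnK.
by split=> //; apply: deg2E.
Qed.

End BlueAction.

(** * The representation on blue paths *)

Section BluePathRepresentation.
Variables (K : fieldType) (L : twoGraph) (lev : vert L -> nat).
Hypothesis rf : row_finite L.
Hypothesis ns : no_sources L.
Hypothesis red1 : forall v : vert L, exists! f : gpath L, deg f = e2 /\ rmap f = v.
Hypothesis finV : forall n, finite_set [set v | lev v = n].
Hypothesis lev_blue : forall e : gpath L, deg e = e1 -> lev (smap e) = (lev (rmap e)).+1.
Hypothesis lev_red : forall f : gpath L, deg f = e2 -> lev (smap f) = lev (rmap f).
Implicit Types a b c l m : gpath L.

Definition blue_fset N := fset_set [set a : gpath L | blue a /\ lev (smap a) = N].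
Local Notation blue_paths N := (fset_sub_type (blue_fset N)).

Let finX N : finite_set [set a | blue a /\ lev (smap a) = N].
Proof. exact: finite_blue_paths. Qed.

Lemma blue_pathsP N (x : blue_paths N) : blue (val x) /\ lev (smap (val x)) = N.
Proof. by have := valP x; rewrite /blue_fset in_fset_set // inE. Qed.

Lemma blue_paths_ex a : blue a -> exists x : blue_paths (lev (smap a)), val x = a.
Proof.
move=> ha; have h : a \in blue_fset (lev (smap a)).
  by rewrite /blue_fset in_fset_set // inE.
by exists (FSetSub h).
Qed.

Definition act_mx l : mxseq K (fun N => #|blue_paths N|) :=
  fun N => relmx K (fun x y : blue_paths N => blue_act l (val x) (val y)).

Let inX N a : blue a -> lev (smap a) = N -> exists x : blue_paths N, val x = a.
Proof. by move=> ha <-; exact: blue_paths_ex. Qed.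

Let bx N (x : blue_paths N) : blue (val x). Proof. by case: (blue_pathsP x). Qed.

Let act_inj l N (x y z : blue_paths N) :
  blue_act l (val x) (val y) -> blue_act l (val x) (val z) -> y = z.
Proof.
move=> h1 h2; apply: val_inj.
by have [] := blue_act_same red1 (bx y) (bx x) (bx z) (erefl (deg l)) h1 h2.
Qed.

Lemma act_mx_comp l m N : smap l = rmap m ->
  act_mx l N *m act_mx m N = act_mx (pcomp l m) N.
Proof.
move=> h; rewrite /act_mx relmx_mul; last first.
  by move=> x y y' z h1 _ h2 _; exact: act_inj h1 h2.
apply: relmx_ext => x z; rewrite blue_act_comp //; split.
  by move=> [y [h1 h2]]; exists (val y).
move=> [b [hb h1 h2]].
have [y ey] : exists y : blue_paths N, val y = b.
  apply: inX => //; rewrite (blue_act_lev lev_blue lev_red h2).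
  by case: (blue_pathsP z).
by exists y; rewrite ey.
Qed.

Lemma act_mx_idE v N :
  act_mx (idp v) N = relmx K (fun x y : blue_paths N => x = y /\ rmap (val y) = v).
Proof.
apply: relmx_ext => x y; rewrite blue_act_id //; split=> -[e h]; split=> //.
  exact: val_inj.
by rewrite e.
Qed.

Lemma act_mx_id_tr v N : (act_mx (idp v) N)^T = act_mx (idp v) N.
Proof.
by rewrite act_mx_idE relmx_tr; apply: relmx_ext => x y; split=> -[<- h].
Qed.

Lemma act_mx_orth v w N : v != w -> act_mx (idp v) N *m act_mx (idp w) N = 0.
Proof.
move=> /eqP vw; rewrite !act_mx_idE relmx_mul => [|x y y' z [<- _] _ [<-]//].
by apply: relmx0 => x z [y [[_ h] [e h']]]; apply: vw; rewrite -h -h' e.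
Qed.

Lemma act_mx_ts l m N : deg l = deg m ->
  (act_mx l N)^T *m act_mx m N = if l == m then act_mx (idp (smap l)) N else 0.
Proof.
move=> d; rewrite relmx_tr relmx_mul; last first.
  by move=> x y y' z h1 _ h2 _; apply: val_inj; exact: blue_act_fun h1 h2.
have key (x y z : blue_paths N) : blue_act l (val y) (val x) ->
    blue_act m (val y) (val z) -> l = m /\ x = z.
  move=> h1 h2; have [-> /val_inj] := blue_act_same red1 (bx x) (bx y) (bx z) d h1 h2.
  by split.
case: eqP => [<-|ne]; last by apply: relmx0 => x z [y [h1 /(key _ _ _ h1)[]]].
rewrite act_mx_idE; apply: relmx_ext => x z; split.
  by move=> [y [h1 h2]]; split; [exact: act_inj h1 h2|case: h2].
move=> [<- /esym h]; have [b [hb lb]] := blue_act_ex h.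
have [y ey] : exists y : blue_paths N, val y = b.
  by apply: inX => //; rewrite (blue_act_lev lev_blue lev_red lb); case: (blue_pathsP x).
by exists y; rewrite ey.
Qed.

(* A blue path from v to V_N has degree N - lev v, so it is long enough to
   absorb the blue part of a path of degree n. *)
Lemma act_mx_expand v n N (X : seq (gpath L)) : (lev v + n.1 <= N)%N ->
  uniq X -> (forall l, l \in X <-> paths_from v n l) ->
  \sum_(l <- X) act_mx l N *m (act_mx l N)^T = act_mx (idp v) N.
Proof.
move=> vN uX hX.
have e l : act_mx l N *m (act_mx l N)^T = relmx K (fun x z : blue_paths N =>
    exists y : blue_paths N, blue_act l (val x) (val y) /\ blue_act l (val z) (val y)).
  rewrite relmx_tr relmx_mul // => x y y' z h1 _ h2 _; exact: act_inj h1 h2.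
rewrite big_seq; under eq_bigr do rewrite e; rewrite -big_seq.
rewrite act_mx_idE.
have -> : \sum_(l <- X) relmx K (fun x z : blue_paths N => exists y : blue_paths N,
      blue_act l (val x) (val y) /\ blue_act l (val z) (val y)) =
    \sum_(l <- X) relmx K (fun x z : blue_paths N => l \in X /\ exists y : blue_paths N,
      blue_act l (val x) (val y) /\ blue_act l (val z) (val y)).
  rewrite big_seq [RHS]big_seq; apply: eq_bigr => l lX.
  by apply: relmx_ext => x z; split=> [|[]].
rewrite relmx_sum //; last first.
  move=> l m x z [/hX[_ dl] [y [h1 _]]] [/hX[_ dm] [y' [h2 _]]].
  by have [] := blue_act_same red1 (bx y) (bx x) (bx y') (etrans dl (esym dm)) h1 h2.
apply: relmx_ext => x z; split.
  move=> [l _ [/hX[rl _] [y [h1 h2]]]]; split; last by rewrite -rl -(blue_act_rmap h2).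
  by apply: val_inj; exact: blue_act_fun h1 h2.
move=> [<- rx].
have nx : (n.1 <= (deg (val x)).1)%N.
  have := lev_path lev_blue lev_red (val x); rewrite rx; case: (blue_pathsP x) => _ ->.
  by lia.
have [l [b [pl hb lb]]] := blue_act_expand ns (bx x) nx.
have [y ey] : exists y : blue_paths N, val y = b.
  apply: inX => //; rewrite -(blue_act_lev lev_blue lev_red lb).
  by case: (blue_pathsP x).
have lX : l \in X by apply/hX; rewrite -rx.
by exists l => //; split=> //; exists y; rewrite ey.
Qed.

Definition rep_s l : mxgerm K (fun N => #|blue_paths N|) := germ (act_mx l).
Definition rep_t l : mxgerm K (fun N => #|blue_paths N|) :=
  germ (fun N => (act_mx l N)^T).

Lemma rep_s_comp l m : smap l = rmap m -> rep_s l ** rep_s m = rep_s (pcomp l m).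
Proof. by move=> h; rewrite germM; apply: germ_ext => N; exact: act_mx_comp. Qed.

Lemma rep_t_comp l m : smap l = rmap m -> rep_t m ** rep_t l = rep_t (pcomp l m).
Proof.
move=> h; rewrite germM; apply: germ_ext => N.
by rewrite -trmx_mul act_mx_comp.
Qed.

Lemma rep_t_id v : rep_t (idp v) = rep_s (idp v).
Proof. by apply: germ_ext => N; exact: act_mx_id_tr. Qed.

Lemma rep_family : KP_family (fun v => rep_s (idp v))
  (fun l : npath L => rep_s (val l)) (fun l : npath L => rep_t (val l)).
Proof.
split.
- move=> v w; case: eqP => [<-|/eqP vw].
    by rewrite rep_s_comp ?smap_id ?rmap_id // -{2}[v](@smap_id L) comp_idr.
  by rewrite germM germ0; apply: germ_ext => N; exact: act_mx_orth.
- by move=> l m n h ->; exact: rep_s_comp.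
- by move=> l m n h ->; exact: rep_t_comp.
- by move=> l; rewrite rep_s_comp ?smap_id ?comp_idl.
- by move=> l; rewrite rep_s_comp ?rmap_id ?comp_idr.
- by move=> l; rewrite -rep_t_id rep_t_comp ?rmap_id ?comp_idr.
- by move=> l; rewrite -rep_t_id rep_t_comp ?smap_id ?comp_idl.
- move=> l m d; rewrite germM -(inj_eq val_inj) /=.
  case: eqP => lm; [|rewrite germ0]; apply: germ_ext => N; rewrite act_mx_ts //.
    by rewrite lm eqxx.
  by case: eqP lm.
move=> v n n0.
have fin : finite_set [set l : npath L | paths_from v n (val l)].
  by apply: (finite_preimage _ (rf v n)) => l m _ _; exact: val_inj.
rewrite fsbig_finite //.
set X := enum_fset _.
under eq_bigr do rewrite germM.
(* From level lev v + n.1 on, all blue paths with range v are long enough for (KP4); below it the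
   relation may fail, which is why germs are taken. *)
rewrite germ_sum; apply/germ_eqP; exists (lev v + n.1)%N => N hN.
rewrite -(big_map val predT (fun l => act_mx l N *m (act_mx l N)^T)).
rewrite (@act_mx_expand v n) //.
  by rewrite map_inj_uniq ?fset_uniq //; exact: val_inj.
move=> l; split=> [/mapP[u]|h].
  by move=> hu ->; move: hu; rewrite /X in_fset_set // inE.
have nz : deg l != 0 by case: h => _ ->.
apply/mapP; exists (exist (fun l : gpath L => is_true (deg l != 0)) l nz) => //.
by rewrite /X in_fset_set // inE.
Qed.

(** Blue paths from v reach every V_N with N >= lev v, and each one gives a diagonal entry 1. *)
Lemma rep_vertex_neq0 v : rep_s (idp v) <> 0.
Proof.
rewrite germ0 germ_eqP => -[M hM].
have [a [ra da]] := ns v (M, 0%N).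
have [x ex] : exists x : blue_paths (lev v + M)%N, val x = a.
  by apply: inX; rewrite /blue ?(lev_path lev_blue lev_red) ?ra ?da.
apply: (@relmx_neq0 K _ _ x x) (hM (lev v + M)%N (leq_addl _ _)).
by apply/blue_act_id; rewrite ?bx // ex.
Qed.

Let h := KP_lift (fun v => rep_s (idp v))
  (fun l : npath L => rep_s (val l)) (fun l : npath L => rep_t (val l)).

Lemma KP_vertex_neq0 (v : vert L) : kp_v K v <> 0.
Proof.
move=> e; apply: (@rep_vertex_neq0 v).
have := nuhom0 (KP_lift_hom rep_family).
by rewrite -e /KP_lift (kpiK _ rep_family) /=.
Qed.

Lemma KP_no_infinite_idempotent (v : vert L) (p : KP K L) :
  (forall I : set (KP K L), two_sided_ideal I -> I = [set 0] \/ I = setT) ->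
  ~ infinite_idempotent p.
Proof.
move=> simp [pp [p1 [p2 [x [y [[i1 n1 i2 n2] [o12 o21] xy [ps pxy p1yx]]]]]]].
have [[a ea] [b eb]] := xy.
have hh : nuhom h := KP_lift_hom rep_family.
have hv : h (kp_v K v) = rep_s (idp v) by rewrite /h /KP_lift (kpiK _ rep_family).
(* The kernel is an ideal that misses the vertex v, so it is zero; this keeps the images of p1 and
   p2 nonzero. *)
have inj z : h z = 0 -> z = 0.
  have idl : two_sided_ideal [set z | h z = 0].
    split; first split; first split.
    - exact: nuhom0.
    - by move=> u w /= hu hw; rewrite (nuhomB hh) hu hw subr0.
    - by move=> u w /= hu; rewrite (nuhomM hh) hu nmul0r.
    - by move=> u w /= hw; rewrite (nuhomM hh) hw nmulr0.
  case: (simp _ idl) => /seteqP[s1 s2]; first by move=> /s1.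
  by have := s2 (kp_v K v) Logic.I; rewrite /= hv => /rep_vertex_neq0.
apply: (@mxgerm_no_infinite_idempotent _ _ (h p)); split.
  by rewrite /idempotent_elt -(nuhomM hh) pp.
exists (h p1), (h p2), (h x), (h y).
rewrite /idempotent_elt -!(nuhomM hh) i1 i2 o12 o21 -(nuhomD hh) -ps -pxy -p1yx nuhom0 //.
split=> //; first by split=> // /inj.
by split; [exists (h a)|exists (h b)]; rewrite -!(nuhomM hh) -?ea -?eb.
Qed.

End BluePathRepresentation.

(** * Subalgebras and direct limits *)

Record nusubalg (K : fieldType) (A : nuAlgType K) := NuSubalg {
  nusub_mem : A -> bool;
  nusub0 : nusub_mem 0;
  nusubD : forall a b, nusub_mem a -> nusub_mem b -> nusub_mem (a + b);
  nusubZ : forall c a, nusub_mem a -> nusub_mem (c *: a);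
  nusubM : forall a b, nusub_mem a -> nusub_mem b -> nusub_mem (a ** b)
}.

Section Subalgebras.
Variables (K : fieldType) (A : nuAlgType K) (U : nusubalg A).

(** Membership is boolean, so elements are determined by their values and the choice structure is
    inherited. Opposites come from scaling by -1. *)
Definition nusub := {a : A | nusub_mem U a}.
HB.instance Definition _ := Choice.on nusub.

Let mk (a : A) (h : nusub_mem U a) : nusub :=
  exist (fun a => is_true (nusub_mem U a)) a h.
Let valE (x y : nusub) : sval x = sval y -> x = y. Proof. exact: val_inj. Qed.

Definition nusub_zero : nusub := mk (nusub0 U).
Definition nusub_add (x y : nusub) : nusub := mk (nusubD (svalP x) (svalP y)).
Definition nusub_scale c (x : nusub) : nusub := mk (nusubZ c (svalP x)).
Definition nusub_opp (x : nusub) : nusub := nusub_scale (-1) x.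
Definition nusub_mul (x y : nusub) : nusub := mk (nusubM (svalP x) (svalP y)).

Lemma nusub_addA : associative nusub_add.
Proof. by move=> x y z; apply: valE; exact: addrA. Qed.
Lemma nusub_addC : commutative nusub_add.
Proof. by move=> x y; apply: valE; exact: addrC. Qed.
Lemma nusub_add0 : left_id nusub_zero nusub_add.
Proof. by move=> x; apply: valE; exact: add0r. Qed.
Lemma nusub_addN : left_inverse nusub_zero nusub_opp nusub_add.
Proof. by move=> x; apply: valE; rewrite /= scaleN1r addNr. Qed.

HB.instance Definition _ :=
  GRing.isZmodule.Build nusub nusub_addA nusub_addC nusub_add0 nusub_addN.

Lemma nusub_scaleA c e x : nusub_scale c (nusub_scale e x) = nusub_scale (c * e) x.
Proof. by apply: valE; exact: scalerA. Qed.
Lemma nusub_scale1 : left_id 1 nusub_scale.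
Proof. by move=> x; apply: valE; exact: scale1r. Qed.
Lemma nusub_scaleDr : right_distributive nusub_scale +%R.
Proof. by move=> c x y; apply: valE; exact: scalerDr. Qed.
Lemma nusub_scaleDl x : {morph nusub_scale^~ x : c e / c + e}.
Proof. by move=> c e; apply: valE; exact: scalerDl. Qed.

HB.instance Definition _ := GRing.Zmodule_isLmodule.Build K nusub
  nusub_scaleA nusub_scale1 nusub_scaleDr nusub_scaleDl.

Lemma nusub_mulA : associative nusub_mul.
Proof. by move=> x y z; apply: valE; exact: nmulA. Qed.
Lemma nusub_mulDl : left_distributive nusub_mul +%R.
Proof. by move=> x y z; apply: valE; exact: nmulDl. Qed.
Lemma nusub_mulDr : right_distributive nusub_mul +%R.
Proof. by move=> x y z; apply: valE; exact: nmulDr. Qed.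
Lemma nusub_mulZl (c : K) (x y : nusub) : nusub_mul (c *: x) y = c *: nusub_mul x y.
Proof. by apply: valE; exact: nmulZl. Qed.
Lemma nusub_mulZr (c : K) (x y : nusub) : nusub_mul x (c *: y) = c *: nusub_mul x y.
Proof. by apply: valE; exact: nmulZr. Qed.

HB.instance Definition _ := Lmodule_isNuAlgebra.Build K nusub
  nusub_mulA nusub_mulDl nusub_mulDr nusub_mulZl nusub_mulZr.

Lemma nusub_val_hom : nuhom (fun x : nusub => sval x : A).
Proof. by split. Qed.

Lemma nusub_corestrict_hom (B : nuAlgType K) (f : B -> A)
    (h : forall b, nusub_mem U (f b)) :
  nuhom f -> nuhom (fun b => mk (h b) : nusub).
Proof.
move=> [fl fm]; split=> [c a b|a b]; apply: valE; [exact: fl|exact: fm].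
Qed.

End Subalgebras.

(* The union of the images is a subalgebra, through which the identity factors
   by the universal property. *)
Lemma direct_limit_cover (K : fieldType) (D : dirSystem K) (A : nuAlgType K)
    (psi : forall i : ds_index D, ds_obj i -> A) :
  direct_limit psi -> forall a, exists i (b : ds_obj i), psi i b = a.
Proof.
move=> [[hpsi cpsi] univ].
pose mem a := `[< exists i (b : ds_obj i), psi i b = a >].
have common a b : mem a -> mem b ->
    exists k (x y : ds_obj k), psi k x = a /\ psi k y = b.
  move=> /asboolP[i [x <-]] /asboolP[j [y <-]].
  have [k /andP[ik jk]] := ds_directed i j.
  exists k, (ds_map k x), (ds_map k y).
  by split; [exact: (cpsi i k ik x)|exact: (cpsi j k jk y)].
have m0 : mem 0.
  have [i] := ds_inhabited D; apply/asboolP; exists i, 0.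
  exact: nuhom0.
have mD a b : mem a -> mem b -> mem (a + b).
  move=> ma mb; have [k [x [y [<- <-]]]] := common a b ma mb.
  by apply/asboolP; exists k, (x + y); exact: nuhomD.
have mZ c a : mem a -> mem (c *: a).
  by move=> /asboolP[i [x <-]]; apply/asboolP; exists i, (c *: x); exact: nuhomZ.
have mM a b : mem a -> mem b -> mem (a ** b).
  move=> ma mb; have [k [x [y [<- <-]]]] := common a b ma mb.
  by apply/asboolP; exists k, (x ** y); exact: nuhomM.
pose U := NuSubalg m0 mD mZ mM.
have memP i (b : ds_obj i) : nusub_mem U (psi i b) by apply/asboolP; exists i, b.
pose chi i (b : ds_obj i) : nusub U :=
  exist (fun a => is_true (nusub_mem U a)) (psi i b) (memP i b).
have cchi : cocone chi.
  split=> [i|i j ij b]; first exact: nusub_corestrict_hom.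
  by apply: val_inj => /=; exact: (cpsi i j ij b).
have [h [[hh hchi] _]] := univ _ _ cchi.
have [g [_ gu]] := univ A psi (conj hpsi cpsi).
have gid : g = id by apply: gu; split.
have gh : g = (fun x : nusub U => sval x) \o h.
  apply: gu; split; first exact: nuhom_comp hh (nusub_val_hom U).
  by move=> i b /=; have /= -> := hchi i b.
move=> a; have -> : a = sval (h a) by rewrite -{1}[a]/(id a) -gid gh.
by apply/asboolP; exact: (svalP (h a)).
Qed.

(** * Algebraicity in matricial algebras *)

Section Powers.
Variables (K : fieldType) (A : nuAlgType K).

(* The power a ^ (k + 1); A need not have a unit. *)
Fixpoint npowS (a : A) (k : nat) : A := if k is j.+1 then a ** npowS a j else a.

(** The product of the characteristic polynomials of the blocks annihilates every block by
    Cayley-Hamilton. Powers are shifted by one, so the relation obtained is a q(a) = 0, meaningful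
    without a unit. *)
Lemma matricial_algebraic (a : A) : matricial A ->
  exists q : {poly K}, q != 0 /\ \sum_(k < size q) q`_k *: npowS a k = 0.
Proof.
move=> [n [d [phi [bij lin mul]]]].
pose q := \prod_i char_poly (phi a i); exists q.
have qm : q \is monic by apply: monic_prod => i _; exact: char_poly_monic.
split; first exact: monic_neq0.
have phiD i : {morph phi^~ i : x y / x + y}.
  by move=> x y; rewrite -[x]scale1r lin !scale1r.
have phi0 i : phi 0 i = 0 by apply: (addIr (phi 0 i)); rewrite -phiD !add0r.
have phiZ i c x : phi (c *: x) i = c *: phi x i.
  by rewrite -[c *: x]addr0 lin phi0 addr0.
apply: (bij_inj bij); apply: functional_extensionality_dep => i.
rewrite (big_morph (phi^~ i) (phiD i) (phi0 i)) phi0.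
have pow k : phi (npowS a k) i = phi a i * phi a i ^+ k.
  elim: k => [|k IH] /=; first by rewrite expr0 mulr1.
  by rewrite mul IH -mulmxE exprS.
under eq_bigr do rewrite phiZ pow scalerAr.
rewrite -mulr_sumr.
have -> : \sum_(k < size q) q`_k *: phi a i ^+ k = horner_mx (phi a i) q.
  rewrite -[in RHS](coefK q) poly_def linear_sum; apply: eq_bigr => k _.
  by rewrite linearZ /= rmorphXn /= horner_mx_X.
by rewrite /q (bigD1 i) //= rmorphM /= Cayley_Hamilton mul0r mulr0.
Qed.

End Powers.

Lemma nuhom_npowS (K : fieldType) (A B : nuAlgType K) (f : A -> B) a k :
  nuhom f -> f (npowS a k) = npowS (f a) k.
Proof. by move=> hf; elim: k => //= k IH; rewrite (nuhomM hf) IH. Qed.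

(** * Transcendence of red cycles *)

Section RedLoops.
Variables (K : fieldType) (L : twoGraph) (k : nat) (l : gpath L).
Hypothesis rf : row_finite L.
Hypothesis ap : aperiodic L.
Hypothesis nz : forall v : vert L, kp_v K v <> 0.
Hypothesis k0 : (0 < k)%N.
Hypothesis dl : deg l = (0%N, k).
Hypothesis loop : smap l = rmap l.

Let S := path_s (@kp_v K L) (@kp_s K L).
(** This is l^(j + 1), with the same shift as [npowS]. *)
Let lpow j := iter j (pcomp l) l.

Let lpowP j : [/\ rmap (lpow j) = rmap l, smap (lpow j) = rmap l
  & deg (lpow j) = (0%N, (k * j.+1)%N)].
Proof.
elim: j => [|j [r s d]] /=; first by rewrite muln1.
split; rewrite ?rmap_comp ?smap_comp ?r ?s //.
rewrite deg_comp ?r // d dl; apply: deg2E => //=.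
by rewrite -[LHS]/(k + k * j.+1)%N -mulnS.
Qed.

(** The powers of l have different degrees and a common source, so one coefficient of the
    combination can be isolated; taken at the top power, a vanishing sum would make the leading
    coefficient times a vertex zero. *)
Lemma red_loop_not_algebraic (q : {poly K}) : q != 0 ->
  \sum_(j < size q) q`_j *: npowS (S l) j <> 0.
Proof.
move=> q0 e.
have pow j : npowS (S l) j = S (lpow j).
  elim: j => //= j ->; rewrite /S (path_s_comp (KP_is_family K rf)) //.
  by have [-> _ _] := lpowP j.
have inj : injective lpow.
  move=> i j /(congr1 (snd \o @deg L)) /=; have [_ _ ->] := lpowP i.
  by have [_ _ ->] := lpowP j => /= /eqP; rewrite eqn_pmul2l // => /eqP[].
(* The path l^(j + 1) has red degree k(j + 1), so dividing by k and taking the predecessor recovers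
   j. *)
pose f (b : gpath L) := q`_(((deg b).2 %/ k)%N.-1).
have fE j : f (lpow j) = q`_j by rewrite /f; have [_ _ ->] := lpowP j; rewrite /= mulKn.
pose X := map lpow (index_iota 0 (size q)).
have sq : (0 < size q)%N by rewrite size_poly_gt0.
have [|b||u] := @isolate_coef _ _ _ _ _ _ (KP_is_family K rf) (rmap l) X f
    (lpow (size q).-1) ap.
- by rewrite map_inj_uniq ?iota_uniq.
- by move=> /mapP[j _ ->]; have [] := lpowP j.
- by apply: map_f; rewrite mem_index_iota prednK ?leqnn.
rewrite -/S big_map.
have -> : \sum_(0 <= j < size q) f (lpow j) *: S (lpow j) = 0.
  rewrite big_mkord -[RHS]e.
  by apply: eq_bigr => j _; rewrite fE pow.
rewrite nmulr0 nmul0r fE => /esym/eqP; rewrite scaler_eq0 lead_coef_eq0 (negPf q0) /=.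
by move/eqP/nz.
Qed.

End RedLoops.

Theorem theorem5p8 (L : twoGraph) (K : fieldType)
    (hL : rank2_bratteli L) (hcof : cofinal L) (haper : aperiodic L) :
  simple_ring (KP K L) /\
  ~ purely_infinite (KP K L) /\
  ~ locally_matricial (KP K L).
Proof.
have [rf ns [red1 _ loops] [lev [levV lev_blue _ lev_red]]] := hL.
have finV n : finite_set [set v | lev v = n] by case: (levV n).
have [v _] : exists v : vert L, True by have [_ [v _]] := levV 0%N; exists v.
have nz : forall w : vert L, kp_v K w <> 0 by exact: KP_vertex_neq0.
have simp (I : set (KP K L)) : two_sided_ideal I -> I = [set 0] \/ I = setT.
  exact: KP_ideal_trivial.
have nontrivial : exists a b : KP K L, a ** b <> 0.
  exists (kp_v K v), (kp_v K v); rewrite (KP1 (KP_is_family K rf)) eqxx; exact: nz.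
split; first by split.
split.
  have T0 : (setT : set (KP K L)) <> [set 0].
    by move=> /seteqP[/(_ (kp_v K v) Logic.I) /nz].
  (* The whole algebra is a nonzero right ideal, so it would contain an infinite idempotent. *)
  move=> /(_ setT); case=> // p [_].
  exact: (KP_no_infinite_idempotent rf ns red1 finV lev_blue lev_red v).
move=> [D [psi [mat lim]]].
have [k [l [k0 dl rl sl]]] := loops v.
(* S_l comes from some b in a matricial stage, and the polynomial relation of b is carried to S_l by
   [psi i]. *)
have [i [b eb]] := direct_limit_cover lim (path_s (@kp_v K L) (@kp_s K L) l).
have [q [q0 e]] := matricial_algebraic b (mat i).
have hi : nuhom (psi i) by case: lim => -[].
have loop : smap l = rmap l by rewrite rl sl.
apply: (red_loop_not_algebraic rf haper nz k0 dl loop q0).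
rewrite -eb -[RHS](nuhom0 hi) -e (nuhom_sum hi); apply: eq_bigr => j _.
by rewrite (nuhomZ hi) (nuhom_npowS _ _ hi).
Qed.
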